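(* Let $M$ be a von Neumann algebra and let $\delta:M\to M$ be a linear map (not assumed continuous). Suppose $\delta$ is a derivation at zero. Then $\delta$ is a continuous generalized derivation. If additionally $\delta(1)=0$, then $\delta$ is a derivation.
   Context: A linear map $\delta:M\to M$ is a derivation at zero if $\delta(a)b+a\delta(b)=0$ for all $a,b\in M$ with $ab=0$. It is a derivation if $\delta(ab)=\delta(a)b+a\delta(b)$ for all $a,b\in M$. It is a generalized derivation if there exists $\xi\in M^{**}$ such that $\delta(ab)=\delta(a)b+a\delta(b)-a\xi b$ for all $a,b\in M$ (products taken in $M^{**}$). *)

(* Defs.v *)
From HB Require Import structures.
From mathcomp Require Import all_boot all_order all_algebra sesquilinear.
From mathcomp Require Import complex.
From mathcomp Require Import all_classical all_reals.
From mathcomp Require Import topology normedtype.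

Set Implicit Arguments.
Unset Strict Implicit.
Unset Printing Implicit Defensive.

Import Order.TTheory GRing.Theory Num.Def Num.Theory.
Import numFieldTopology.Exports numFieldNormedType.Exports.

Local Open Scope classical_set_scope.
Local Open Scope ring_scope.
Local Open Scope complex_scope.

Section BoundedOperators.
Context {R : realType}.
Implicit Types V W : normedModType R[i].

Definition bounded_linear V W : {pred V -> W} :=
  [pred f : V -> W | `[< linear f /\ continuous f >]].

Record bounded_op V W := BoundedOp {
  bounded_op_fun :> V -> W;
  _ : bounded_op_fun \in @bounded_linear V W }.

HB.instance Definition _ V W := [isSub for @bounded_op_fun V W].
HB.instance Definition _ V W := [Choice of bounded_op V W by <:].

Lemma real_complexD (x y : R) : (x + y)%:C = x%:C + y%:C :> R[i].
Proof. exact: rmorphD. Qed.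

Lemma real_complexM (x y : R) : (x * y)%:C = x%:C * y%:C :> R[i].
Proof. exact: rmorphM. Qed.

Lemma Re_normK V (x : V) : (complex.Re `|x|)%:C = `|x|.
Proof. by rewrite RRe_real ?normr_real. Qed.

Lemma Re_norm_ge0 V (x : V) : 0 <= complex.Re `|x|.
Proof. by rewrite -ler0c Re_normK. Qed.

Lemma bounded_linearP V W (f : V -> W) :
  reflect (linear f /\
           exists2 k : R, 0 <= k & forall x, `|f x| <= k%:C * `|x|)
    (f \in @bounded_linear V W).
Proof.
rewrite inE /=; apply: (iffP (asboolP _)) => -[lf].
  move=> cf; split => //.
  pose F := GRing.isLinear.Build _ _ _ _ _ lf.
  pose g : {linear V -> W} := HB.pack f F.
  have /linear_boundedP/pinfty_ex_gt0[k k0 bf] : bounded_near g (nbhs (0 : V)).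
    exact: (@continuous_linear_bounded _ _ _ 0 g (cf 0)).
  exists (complex.Re k); last by rewrite RRe_real ?gtr0_real.
  by rewrite -lecR RRe_real ?gtr0_real// ltW.
move=> [k k0 bf]; split => //.
pose F := GRing.isLinear.Build _ _ _ _ _ lf.
pose g : {linear V -> W} := HB.pack f F.
apply: (@bounded_linear_continuous _ _ _ g).
apply/linear_boundedP; near=> r => x; apply: (le_trans (bf x)).
rewrite ler_wpM2r//; near: r; apply: nbhs_pinfty_ge.
by rewrite complex_real.
Unshelve. all: by end_near. Qed.

Lemma bounded_linear_submod_closed V W : submod_closed (@bounded_linear V W).
Proof.
split.
  apply/bounded_linearP; split; first by move=> a u v; rewrite scaler0 addr0.
  by exists 0 => // x; rewrite normr0 mul0r.
move=> a f g /bounded_linearP[lf [k k0 kf]] /bounded_linearP[lg [l l0 lg']].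
apply/bounded_linearP; split.
  move=> b u v; rewrite -[LHS]/(a *: f _ + g _) lf lg.
  rewrite -[(a *: f + g) u]/(a *: f u + g u) -[(a *: f + g) v]/(a *: f v + g v).
  by rewrite !scalerDr !scalerA [b * a]mulrC addrACA.
exists (complex.Re `|a : R[i]^o| * k + l).
  by rewrite addr_ge0// mulr_ge0// Re_norm_ge0.
move=> x; rewrite -[X in `|X|]/(a *: f x + g x).
rewrite (le_trans (ler_normD _ _))// normrZ real_complexD real_complexM.
rewrite (Re_normK (a : R[i]^o)) mulrDl lerD// -mulrA.
by rewrite ler_wpM2l.
Qed.

HB.instance Definition _ V W := GRing.isSubmodClosed.Build R[i] (V -> W)
  (@bounded_linear V W) (@bounded_linear_submod_closed V W).
HB.instance Definition _ V W := [SubChoice_isSubLmodule of bounded_op V W by <:].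

Lemma bounded_op_linear V W (f : bounded_op V W) : linear f.
Proof. by have /bounded_linearP[] := valP f. Qed.

HB.instance Definition _ V W (f : bounded_op V W) :=
  GRing.isLinear.Build _ _ _ _ (f : V -> W) (@bounded_op_linear V W f).

Lemma bounded_opP V W (f g : bounded_op V W) : f =1 g -> f = g.
Proof. by move=> fg; apply/val_inj/funext. Qed.

(* The norm of a normedModType R[i] takes values in the real elements of
   R[i]; the supremum is taken in R. *)
Definition opnorm V W (f : bounded_op V W) : R[i] :=
  (sup [set complex.Re `|f x| | x in [set x : V | `|x| <= 1]])%:C.

Lemma Re_le (x y : R[i]) : x <= y -> complex.Re x <= complex.Re y.
Proof. by rewrite lecE => /andP[]. Qed.

Lemma opnorm_le V W (f : bounded_op V W) (k : R) : 0 <= k ->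
  (forall x, `|f x| <= k%:C * `|x|) -> opnorm f <= k%:C.
Proof.
move=> k0 kf; rewrite lecR; apply: ge_sup.
  by exists (complex.Re `|f 0|), 0 => //=; rewrite normr0.
move=> _ [x /= x1 <-]; rewrite -[leRHS]/(complex.Re k%:C).
apply: Re_le; apply: (le_trans (kf x)); rewrite -[leRHS]mulr1.
by rewrite ler_wpM2l// ler0c.
Qed.

Lemma opnorm_bound V W (f : bounded_op V W) : exists2 k : R, 0 <= k &
  ubound [set complex.Re `|f x| | x in [set x : V | `|x| <= 1]] k.
Proof.
have /bounded_linearP[_ [k k0 kf]] := valP f.
exists k => // _ [y /= y1 <-]; rewrite -[leRHS]/(complex.Re k%:C).
apply: Re_le; apply: (le_trans (kf y)); rewrite -[leRHS]mulr1.
by rewrite ler_wpM2l// ler0c.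
Qed.

Lemma opnormP V W (f : bounded_op V W) x : `|f x| <= opnorm f * `|x|.
Proof.
have [->|x0] := eqVneq x 0; first by rewrite linear0 !normr0 mulr0.
have nx0 : 0 < `|x| by rewrite normr_gt0.
rewrite -ler_pdivrMr// mulrC.
have -> : `|x|^-1 * `|f x| = `|f (`|x|^-1 *: x)|.
  by rewrite linearZ/= normrZ gtr0_norm// invr_gt0.
rewrite -[leLHS](RRe_real (normr_real _)) lecR.
apply: ub_le_sup; last first.
  by exists (`|x|^-1 *: x) => //=; rewrite normrZ gtr0_norm ?invr_gt0// mulVf ?gt_eqF.
by have [k _ kf] := opnorm_bound f; exists k.
Qed.

Lemma opnorm_ge0 V W (f : bounded_op V W) : 0 <= opnorm f.
Proof.
rewrite ler0c; have [k k0 kE] := opnorm_bound f.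
apply: (@le_trans _ _ (complex.Re `|f 0|)); first exact: Re_norm_ge0.
apply: ub_le_sup; last by exists 0 => //=; rewrite normr0.
by exists k.
Qed.

Lemma opnorm_real V W (f : bounded_op V W) : exists2 k : R, 0 <= k & opnorm f = k%:C.
Proof. by exists (complex.Re (opnorm f)) => //; rewrite -ler0c; exact: opnorm_ge0. Qed.

Lemma ler_opnormD V W (f g : bounded_op V W) :
  opnorm (f + g) <= opnorm f + opnorm g.
Proof.
have [k k0 kE] := opnorm_real f; have [l l0 lE] := opnorm_real g.
rewrite kE lE -real_complexD; apply: opnorm_le; first exact: addr_ge0.
move=> x; rewrite -[(f + g) x]/(f x + g x) (le_trans (ler_normD _ _))//.
by rewrite real_complexD mulrDl lerD// -?kE -?lE opnormP.
Qed.

Lemma opnormZ_le V W (a : R[i]) (f : bounded_op V W) :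
  opnorm (a *: f) <= `|a| * opnorm f.
Proof.
have [k k0 kE] := opnorm_real f.
rewrite kE -(Re_normK (a : R[i]^o)) -real_complexM; apply: opnorm_le.
  by rewrite mulr_ge0// Re_norm_ge0.
move=> x; rewrite -[(a *: f) x]/(a *: f x) normrZ real_complexM.
by rewrite (Re_normK (a : R[i]^o)) -mulrA ler_wpM2l// -kE opnormP.
Qed.

Lemma opnormZ V W (a : R[i]) (f : bounded_op V W) :
  opnorm (a *: f) = `|a| * opnorm f.
Proof.
apply/eqP; rewrite eq_le opnormZ_le /=.
have [->|a0] := eqVneq a 0; first by rewrite normr0 mul0r opnorm_ge0.
rewrite -{1}[f]scale1r -(mulVf a0) -scalerA mulrC -ler_pdivlMr ?normr_gt0//.
by rewrite mulrC -normfV opnormZ_le.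
Qed.

Lemma opnorm0_eq0 V W (f : bounded_op V W) : opnorm f = 0 -> f = 0.
Proof.
move=> f0; apply: bounded_opP => x; apply/eqP; rewrite -normr_le0.
by rewrite (le_trans (opnormP f x))// f0 mul0r.
Qed.

HB.instance Definition _ V W := Lmodule_isNormed.Build R[i] (bounded_op V W)
  (@ler_opnormD V W) (@opnormZ V W) (@opnorm0_eq0 V W).

Lemma bounded_op_normE V W (f : bounded_op V W) : `|f| = opnorm f.
Proof. by []. Qed.

Lemma id_op_subproof V : idfun \in @bounded_linear V V.
Proof.
by apply/bounded_linearP; split => //; exists 1 => // x; rewrite mul1r.
Qed.
Definition id_op V : bounded_op V V := BoundedOp (id_op_subproof V).

Lemma comp_op_subproof V (f g : bounded_op V V) : f \o g \in @bounded_linear V V.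
Proof.
apply/bounded_linearP; split; first by move=> a u v /=; rewrite !linearP.
have [k k0 kE] := opnorm_real f; have [l l0 lE] := opnorm_real g.
exists (k * l); first exact: mulr_ge0.
move=> x /=; rewrite (le_trans (opnormP _ _))// kE real_complexM -mulrA.
by rewrite ler_wpM2l ?ler0c// -lE opnormP.
Qed.
Definition comp_op V (f g : bounded_op V V) : bounded_op V V :=
  BoundedOp (comp_op_subproof f g).

Fact comp_opA V : associative (@comp_op V).
Proof. by move=> f g h; apply: bounded_opP. Qed.
Fact comp_op1l V : left_id (id_op V) (@comp_op V).
Proof. by move=> f; apply: bounded_opP. Qed.
Fact comp_op1r V : right_id (id_op V) (@comp_op V).
Proof. by move=> f; apply: bounded_opP. Qed.
Fact comp_opDl V : left_distributive (@comp_op V) +%R.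
Proof. by move=> f g h; apply: bounded_opP. Qed.
Fact comp_opDr V : right_distributive (@comp_op V) +%R.
Proof.
move=> f g h; apply: bounded_opP => x.
by rewrite -[LHS]/(f (g x + h x)) linearD.
Qed.

HB.instance Definition _ V := GRing.Zmodule_isPzRing.Build (bounded_op V V)
  (@comp_opA V) (@comp_op1l V) (@comp_op1r V) (@comp_opDl V) (@comp_opDr V).

Lemma bounded_op_scaleAl V (a : R[i]) (f g : bounded_op V V) :
  a *: (f * g) = (a *: f) * g.
Proof. exact: bounded_opP. Qed.

Lemma bounded_op_scaleAr V (a : R[i]) (f g : bounded_op V V) :
  a *: (f * g) = f * (a *: g).
Proof. by apply: bounded_opP => x; rewrite -[RHS]/(f (a *: g x)) linearZ. Qed.

Lemma bounded_op_normM V (f g : bounded_op V V) : `|f * g| <= `|f| * `|g|.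
Proof.
rewrite !bounded_op_normE.
have [k k0 kE] := opnorm_real f; have [l l0 lE] := opnorm_real g.
rewrite kE lE -real_complexM; apply: opnorm_le; first exact: mulr_ge0.
move=> x; rewrite -[(f * g) x]/(f (g x)) (le_trans (opnormP _ _))//.
by rewrite kE real_complexM -mulrA ler_wpM2l ?ler0c// -lE opnormP.
Qed.

End BoundedOperators.

Section Arens.
Context {R : realType}.
Implicit Types X Y Z : normedModType R[i].

Definition dual X : normedModType R[i] := bounded_op X R[i]^o.

Definition bidual X : normedModType R[i] := dual (dual X).

Record bounded_bilinear X Y Z := BoundedBilinear {
  bilin_fun :> X -> Y -> Z;
  bilin_linearl : forall y, linear (bilin_fun ^~ y);
  bilin_linearr : forall x, linear (bilin_fun x);
  bilin_bounded : exists2 k : R, 0 <= k &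
    forall x y, `|bilin_fun x y| <= k%:C * `|x| * `|y| }.

Lemma evaluation_subproof X (x : X) :
  (fun phi : dual X => phi x : R[i]^o) \in @bounded_linear R (dual X) R[i]^o.
Proof.
apply/bounded_linearP; split; first by [].
exists (complex.Re `|x|); first by rewrite -ler0c RRe_real ?normr_real.
by move=> phi; rewrite RRe_real ?normr_real// mulrC opnormP.
Qed.

Definition evaluation X (x : X) : bidual X := BoundedOp (evaluation_subproof x).

Section Transpose.
Variables (X Y Z : normedModType R[i]) (m : bounded_bilinear X Y Z).

Lemma transpose_subproof (phi : dual Z) (x : X) :
  (fun y => phi (m x y)) \in @bounded_linear R Y R[i]^o.
Proof.
apply/bounded_linearP; split.
  by move=> a u v; rewrite (bilin_linearr m) linearP.
have [k k0 mk] := bilin_bounded m.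
have [p p0 pE] := opnorm_real phi.
exists (p * (k * complex.Re `|x|)).
  by rewrite !mulr_ge0 ?Re_norm_ge0.
move=> y; rewrite (le_trans (opnormP _ _))// pE 2!real_complexM Re_normK.
by rewrite -mulrA ler_wpM2l ?ler0c.
Qed.

Let tr (phi : dual Z) (x : X) : dual Y := BoundedOp (transpose_subproof phi x).

Lemma transpose_linearl x : linear (tr ^~ x).
Proof. by move=> a phi psi; apply: bounded_opP. Qed.

Lemma transpose_linearr phi : linear (tr phi).
Proof.
move=> a u v; apply: bounded_opP => y.
by rewrite /= (bilin_linearl m) linearP.
Qed.

Lemma transpose_bounded : exists2 k : R, 0 <= k &
  forall phi x, `|tr phi x| <= k%:C * `|phi| * `|x|.
Proof.
have [k k0 mk] := bilin_bounded m.
exists k => // phi x; have [p p0 pE] := opnorm_real phi.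
rewrite !bounded_op_normE pE -Re_normK -!real_complexM.
apply: opnorm_le => [|y]; first by rewrite !mulr_ge0 ?Re_norm_ge0.
rewrite /= (le_trans (opnormP _ _))// pE !real_complexM Re_normK.
by rewrite (mulrC k%:C) -!mulrA ler_wpM2l ?ler0c// mulrA.
Qed.

Definition transpose : bounded_bilinear (dual Z) X (dual Y) :=
  BoundedBilinear transpose_linearl transpose_linearr transpose_bounded.

End Transpose.

(* With m the product of an algebra, this is the first Arens product:
   arens m xi eta phi = xi (fun x => eta (fun y => phi (m x y))). *)
Definition arens X Y Z (m : bounded_bilinear X Y Z) :
    bounded_bilinear (bidual X) (bidual Y) (bidual Z) :=
  transpose (transpose (transpose m)).

Lemma arens_evaluation X Y Z (m : bounded_bilinear X Y Z) x y :
  arens m (evaluation x) (evaluation y) = evaluation (m x y).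
Proof. exact: bounded_opP. Qed.

End Arens.

HB.mixin Record NormedModule_isHilbert (R : realType) H
    & CompleteNormedModule R[i] H := {
  inner : {dot H for @conjc R};
  normr_inner : forall x : H, `|x| ^+ 2 = inner x x }.

#[short(type="hilbertType")]
HB.structure Definition Hilbert (R : realType) :=
  {H of CompleteNormedModule R[i] H & NormedModule_isHilbert R H}.

Section VonNeumann.
Context {R : realType} (H : hilbertType R).
Local Notation BH := (bounded_op H H).

Definition is_adjoint (a b : BH) :=
  forall x y : H, inner (a x) y = inner x (b y).

Definition commutant (S : set BH) : set BH :=
  [set b | forall a, S a -> GRing.comm a b].

(* A commutant is a unital subalgebra, so these two conditions say that vna_set
   is a *-subalgebra of B(H) equal to its bicommutant. *)
Record vonNeumannAlgebra := VonNeumannAlgebra {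
  vna_set : set BH;
  vna_star : forall a, vna_set a -> exists2 b, vna_set b & is_adjoint a b;
  vna_bicommutant : commutant (commutant vna_set) = vna_set }.

End VonNeumann.

Section VonNeumannTheory.
Context {R : realType} {H : hilbertType R}.
Implicit Type M : vonNeumannAlgebra H.
Local Notation BH := (bounded_op H H).

Definition vna_mem M : {pred BH} := fun a => a \in vna_set M.

Record vna_elt M := VnaElt { vna_val :> BH; _ : vna_val \in vna_mem M }.

HB.instance Definition _ M := [isSub for @vna_val M].
HB.instance Definition _ M := [Choice of vna_elt M by <:].

Lemma vna_memP M (a : BH) :
  reflect (forall b, commutant (vna_set M) b -> b * a = a * b) (a \in vna_mem M).
Proof.
have E : vna_set M a = commutant (commutant (vna_set M)) a.
  by rewrite vna_bicommutant.
apply: (iffP idP) => [/set_mem|Ma]; first by rewrite E => + b Mb; exact.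
by apply/mem_set; rewrite E.
Qed.

Lemma vna_subring_closed M : subring_closed (vna_mem M).
Proof.
split.
- by apply/vna_memP => b _; rewrite mulr1 mul1r.
- move=> x y /vna_memP Mx /vna_memP My; apply/vna_memP => b Mb.
  by rewrite mulrBr mulrBl Mx// My.
- move=> x y /vna_memP Mx /vna_memP My; apply/vna_memP => b Mb.
  by rewrite mulrA Mx// -!mulrA My.
Qed.

Lemma vna_scaler_closed M : GRing.scaler_closed (vna_mem M).
Proof.
move=> a x /vna_memP Mx; apply/vna_memP => b Mb.
by rewrite -bounded_op_scaleAl -bounded_op_scaleAr Mx.
Qed.

HB.instance Definition _ M := GRing.isSubringClosed.Build BH (vna_mem M)
  (@vna_subring_closed M).
HB.instance Definition _ M := GRing.isScaleClosed.Build R[i] BH (vna_mem M)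
  (@vna_scaler_closed M).
HB.instance Definition _ M := [SubChoice_isSubLmodule of vna_elt M by <:].
HB.instance Definition _ M := GRing.SubZmodule_isSubPzRing.Build BH (vna_mem M)
  (vna_elt M) (@vna_subring_closed M).

Let vna_norm M (a : vna_elt M) : R[i] := `|vna_val a|.

Let ler_vna_normD M (a b : vna_elt M) :
  vna_norm (a + b) <= vna_norm a + vna_norm b.
Proof. exact: ler_normD. Qed.

Let vna_normZ M (c : R[i]) (a : vna_elt M) : vna_norm (c *: a) = `|c| * vna_norm a.
Proof. exact: normrZ. Qed.

Let vna_norm0_eq0 M (a : vna_elt M) : vna_norm a = 0 -> a = 0.
Proof. by move=> /normr0_eq0 a0; apply: val_inj. Qed.

HB.instance Definition _ M := Lmodule_isNormed.Build R[i] (vna_elt M)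
  (@ler_vna_normD M) (@vna_normZ M) (@vna_norm0_eq0 M).

Lemma vna_mul_linearl M (b : vna_elt M) : linear (fun a : vna_elt M => a * b).
Proof.
move=> c u v; apply: val_inj.
by rewrite /= mulrDl -bounded_op_scaleAl.
Qed.

Lemma vna_mul_linearr M (a : vna_elt M) : linear (fun b : vna_elt M => a * b).
Proof.
move=> c u v; apply: val_inj.
by rewrite /= mulrDr -bounded_op_scaleAr.
Qed.

Lemma vna_mul_bounded M : exists2 k : R, 0 <= k &
  forall a b : vna_elt M, `|a * b| <= k%:C * `|a| * `|b|.
Proof. by exists 1 => // a b; rewrite mul1r; exact: bounded_op_normM. Qed.

Definition vna_mul M : bounded_bilinear (vna_elt M) (vna_elt M) (vna_elt M) :=
  BoundedBilinear (@vna_mul_linearl M) (@vna_mul_linearr M) (vna_mul_bounded M).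

End VonNeumannTheory.

Coercion vna_elt : vonNeumannAlgebra >-> Sortclass.

Definition derivation_at_zero (A : pzRingType) (delta : A -> A) :=
  forall a b : A, a * b = 0 -> delta a * b + a * delta b = 0.

Definition derivation (A : pzRingType) (delta : A -> A) :=
  forall a b : A, delta (a * b) = delta a * b + a * delta b.

(* M^** is a C*-algebra, so the two Arens products on it coincide. *)
Definition generalized_derivation (R : realType) (H : hilbertType R)
    (M : vonNeumannAlgebra H) (delta : M -> M) :=
  let J := @evaluation R M in
  let mul := arens (vna_mul M) in
  exists xi : bidual M, forall a b : M,
    J (delta (a * b)) =
      mul (J (delta a)) (J b) + mul (J a) (J (delta b))
      - mul (mul (J a) xi) (J b).

(* Main.v *)
Require Import Defs.
From HB Require Import structures.
From mathcomp Require Import all_boot all_order all_algebra sesquilinear.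
From mathcomp Require Import complex ring lra.
From mathcomp Require Import all_classical all_reals topology normedtype sequences.

Set Implicit Arguments.
Unset Strict Implicit.
Unset Printing Implicit Defensive.

Import Order.TTheory GRing.Theory Num.Def Num.Theory.
Import numFieldTopology.Exports numFieldNormedType.Exports.

Local Open Scope classical_set_scope.
Local Open Scope ring_scope.
Local Open Scope complex_scope.

(** Write D for a linear map which is a derivation at zero.  For an idempotent e
    the products (x e)(1 - e) and (x (1 - e)) e vanish; the two resulting
    equations differ exactly by the Leibniz rule D(x e) = D(x) e + x D(e), up to
    a term in D(1), and for x = 1 they say that D(1) commutes with e.  So the
    theorem is a matter of passing from projections to all of M.

    Projections span a norm dense subspace of M: this is used in the form
    [vanish_on_projections], that a bounded linear map killing all projections is
    zero.  It makes delta(1) central, so that D(a) = delta(a) - delta(1) a is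
    again a derivation at zero, now with D(1) = 0, and it makes D a derivation
    as soon as D is bounded.  Both halves of the theorem follow from
    delta(a) = D(a) + delta(1) a, with xi the canonical image of delta(1).

    The heart is therefore [automatic_continuity]: a linear D satisfying the
    Leibniz rule whenever one factor is a projection is bounded.  Look at the
    coefficients x |-> <D(x) v, w>.  By the uniform boundedness principle the
    vectors w for which all of them are bounded form a closed subspace.  It is
    invariant under the commutant and, by the Leibniz rule, under the projections
    of M, so the projection c on it is central, and D is bounded once c = 1.  If
    e <= 1 - c is a nonzero projection then x |-> e D(x) is unbounded.  A gliding
    hump shows that infinitely many pairwise orthogonal projections cannot all be
    of this kind, so if c <> 1 there is a minimal projection p <= 1 - c.  Then
    p M p is one dimensional, p x p = <x u, u> p, and the Leibniz rule makes
    x |-> p D(x) p bounded.  The vectors v such that <D(x) v, p w> is bounded for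
    all w again form the range of a central projection d, and p <= d.  Since
    p D(x) (1 - d) = p (1 - d) D(x) = 0, these coefficients are bounded for every
    v, that is p <= c: a contradiction.

    Density of the projections needs no functional calculus.  For a self-adjoint
    contraction a, the fixed point y of y = (1 - a^2 + y^2) / 2 gives
    r = 1 - y with r^2 = a^2.  If e is the projection on the kernel of r - a, then
    s = 2 e - 1 is a symmetry with s r = a, and the norm of a - s / 2 is at most
    7 / 8.  Subtracting such multiples of symmetries repeatedly, the rest tends
    to zero geometrically. *)

(** * Real-valued norms and bounded maps *)

Section RealNorm.
Context {R : realType}.
Implicit Types V W : normedModType R[i].

(** The norm of a normed module over R[i] takes values in R[i]; estimates are made
    on its real part, to which the order of R and real arithmetic apply. *)
Definition rnorm V (x : V) : R := complex.Re `|x|.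

Lemma rnormE V (x : V) : (rnorm x)%:C = `|x|.
Proof. exact: Re_normK. Qed.

Lemma rnorm_ge0 V (x : V) : 0 <= rnorm x.
Proof. exact: Re_norm_ge0. Qed.

Lemma rnorm_leP V W (x : V) (y : W) (k : R) :
  (rnorm x <= k * rnorm y) = (`|x| <= k%:C * `|y|).
Proof. by rewrite -!rnormE -real_complexM lecR. Qed.

Lemma rnormD V (x y : V) : rnorm (x + y) <= rnorm x + rnorm y.
Proof. by rewrite -lecR real_complexD !rnormE ler_normD. Qed.

Lemma rnormN V (x : V) : rnorm (- x) = rnorm x.
Proof. by rewrite /rnorm normrN. Qed.

Lemma rnormB V (x y : V) : rnorm (x - y) <= rnorm x + rnorm y.
Proof. by rewrite -[rnorm y]rnormN rnormD. Qed.

Lemma rnormZ V (c : R[i]) (x : V) : rnorm (c *: x) = rnorm (c : R[i]^o) * rnorm x.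
Proof.
by apply: (@complexI R); rewrite real_complexM !rnormE normrZ.
Qed.

Lemma rnorm_real (c : R) : rnorm (c%:C : R[i]^o) = `|c|.
Proof.
by apply: (@complexI R); rewrite rnormE normc_def/= expr0n/= addr0 sqrtr_sqr.
Qed.

Lemma rnormZr V (c : R) (x : V) : rnorm (c%:C *: x) = `|c| * rnorm x.
Proof. by rewrite rnormZ rnorm_real. Qed.

Lemma rnorm0 V : rnorm (0 : V) = 0.
Proof. by rewrite /rnorm normr0. Qed.

Lemma rnorm_le0 V (x : V) : rnorm x <= 0 -> x = 0.
Proof. by move=> x0; apply/eqP; rewrite -normr_le0 -rnormE lecR. Qed.

Lemma rnorm_gt0 V (x : V) : x != 0 -> 0 < rnorm x.
Proof. by move=> x0; rewrite ltNge; apply/negP => /rnorm_le0/eqP; exact/negP. Qed.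

Lemma rnorm_lt_eps V (x : V) : (forall e : R, 0 < e -> rnorm x <= e) -> x = 0.
Proof.
by move=> xe; apply/rnorm_le0/ler_addgt0Pr => e e0; rewrite add0r xe.
Qed.

Lemma rnorm_op V W (f : bounded_op V W) x : rnorm (f x) <= rnorm f * rnorm x.
Proof. by rewrite rnorm_leP rnormE; exact: opnormP. Qed.

Lemma rnorm_op_le V W (f : bounded_op V W) (k : R) : 0 <= k ->
  (forall x, rnorm (f x) <= k * rnorm x) -> rnorm f <= k.
Proof.
move=> k0 kf; rewrite -lecR rnormE; apply: opnorm_le => // x.
by rewrite -rnorm_leP.
Qed.

Definition bounded V W (T : V -> W) := exists C : R, forall x, rnorm (T x) <= C * rnorm x.

Lemma bounded_gt0 V W (T : V -> W) : bounded T ->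
  exists2 C : R, 0 < C & forall x, rnorm (T x) <= C * rnorm x.
Proof.
move=> [C TC]; exists (`|C| + 1) => [|x]; first by rewrite ltr_wpDl.
rewrite (le_trans (TC x))// ler_wpM2r ?rnorm_ge0//.
by rewrite (le_trans (ler_norm C))// lerDl.
Qed.

Lemma boundedD V W (S T : V -> W) : bounded S -> bounded T ->
  bounded (fun x => S x + T x).
Proof.
move=> [C SC] [D TD]; exists (C + D) => x.
by rewrite mulrDl (le_trans (rnormD _ _))// lerD.
Qed.

Lemma boundedN V W (T : V -> W) : bounded T -> bounded (fun x => - T x).
Proof. by move=> [C TC]; exists C => x; rewrite rnormN. Qed.

Lemma bounded_comp V W (V' : normedModType R[i]) (S : W -> V') (T : V -> W) :
  bounded S -> bounded T -> bounded (fun x => S (T x)).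
Proof.
move=> /bounded_gt0[C C0 SC] [D TD]; exists (C * D) => x.
by rewrite (le_trans (SC _))// -mulrA ler_wpM2l// ltW.
Qed.

Lemma bounded_ext V W (S T : V -> W) : S =1 T -> bounded S -> bounded T.
Proof. by move=> ST [C SC]; exists C => x; rewrite -ST. Qed.

End RealNorm.

(** * Completeness along majorized sequences *)

Section Completeness.
Context {R : realType}.

(** Completeness in the only form used below.  The rate of convergence is part of it,
    so that pointwise limits of operators are also limits in norm. *)
Definition majorant_complete (V : normedModType R[i]) :=
  forall (u : nat -> V) (t : nat -> R) (B : R),
    (forall n, rnorm (u n.+1 - u n) <= t n.+1 - t n) -> t @ \oo --> B ->
  exists l, forall n, rnorm (l - u n) <= B - t n.

Lemma majorant_dist (V : normedModType R[i]) (u : nat -> V) (t : nat -> R) :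
  (forall n, rnorm (u n.+1 - u n) <= t n.+1 - t n) ->
  forall n m, (n <= m)%N -> rnorm (u m - u n) <= t m - t n.
Proof.
move=> ut n m /subnK <-; elim: (m - n)%N => [|k IH].
  by rewrite add0n !subrr rnorm0.
rewrite addSn -(subrK (u (k + n)%N) (u (k + n).+1)) -addrA.
rewrite (le_trans (rnormD _ _))//.
by rewrite -(subrK (t (k + n)%N) (t (k + n).+1)) -addrA lerD.
Qed.

Lemma majorant_nondecreasing (V : normedModType R[i]) (u : nat -> V) (t : nat -> R) :
  (forall n, rnorm (u n.+1 - u n) <= t n.+1 - t n) -> nondecreasing_seq t.
Proof.
by move=> ut; apply/nondecreasing_seqP => n; rewrite -subr_ge0 (le_trans _ (ut n))// rnorm_ge0.
Qed.

Lemma majorant_le (V : normedModType R[i]) (u : nat -> V) (t : nat -> R) (B : R) :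
  (forall n, rnorm (u n.+1 - u n) <= t n.+1 - t n) -> t @ \oo --> B ->
  forall n, t n <= B.
Proof.
move=> ut tB n; rewrite -(cvg_lim (@Rhausdorff R) tB).
by apply: nondecreasing_cvgn_le; [exact: majorant_nondecreasing ut|apply/cvg_ex; exists B].
Qed.

Lemma cvg_gap_small (t : nat -> R) (B e : R) : t @ \oo --> B -> 0 < e ->
  exists N, forall n, (N <= n)%N -> B - t n < e.
Proof.
move=> tB e0; move/cvgrPdist_lt : tB => /(_ e e0)[N _ NB].
by exists N => n /NB /= /ltr_normlW.
Qed.

Lemma posC_real (e : R[i]) : 0 < e -> exists2 r : R, 0 < r & e = r%:C.
Proof.
move=> e0; have eE : e = (complex.Re e)%:C by rewrite RRe_real// gtr0_real.
by exists (complex.Re e) => //; rewrite -ltcR -eE.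
Qed.

Lemma complete_majorant (V : completeNormedModType R[i]) : majorant_complete V.
Proof.
move=> u t B ut tB; have tle := majorant_le ut tB.
have : cvg (u @ \oo).
  apply/cauchy_cvgP/cauchy_exP => _ /posC_real[e e0 ->].
  have [N NB] := cvg_gap_small tB e0.
  exists (u N); exists N => // n /= Nn.
  rewrite -ball_normE/= distrC -rnormE ltcR.
  by rewrite (le_lt_trans (majorant_dist ut Nn))// (le_lt_trans _ (NB N _))// lerB.
move=> /cvg_ex[/= l ul]; exists l => n.
apply/ler_addgt0Pr => e e0.
move/cvgrPdist_le : ul => /(_ e%:C); rewrite ltcR => /(_ e0)[N _ NB].
have /= := NB (maxn N n) (leq_maxl _ _); rewrite -rnormE lecR => {}NB.
rewrite -(subrK (u (maxn N n)) l) -addrA (le_trans (rnormD _ _))//.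
rewrite [leRHS]addrC lerD//.
by rewrite (le_trans (majorant_dist ut (leq_maxr N n)))// lerB.
Qed.

(** Two limits of the same majorized sequence agree even when the rates are known
    only up to constant factors; this identifies limits taken vector by vector. *)
Lemma majorant_limit_unique (V : normedModType R[i]) (l l' : V) (u : nat -> V)
    (t : nat -> R) (B c c' : R) : (forall n, t n <= B) -> t @ \oo --> B ->
  (forall n, rnorm (l - u n) <= (B - t n) * c) ->
  (forall n, rnorm (l' - u n) <= (B - t n) * c') -> l = l'.
Proof.
move=> tle tB lu l'u; apply/eqP; rewrite -subr_eq0; apply/eqP/rnorm_lt_eps => e e0.
have K0 : 0 < `|c| + `|c'| + 1 by rewrite ltr_wpDl ?addr_ge0.
have [n nP] := cvg_gap_small tB (divr_gt0 e0 K0).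
have -> : l - l' = l - u n - (l' - u n) by rewrite opprB addrA subrK.
rewrite (le_trans (rnormB _ _))// (le_trans (lerD (lu n) (l'u n)))// -mulrDr.
have := nP n (leqnn _); rewrite ltr_pdivlMr// => /ltW; apply: le_trans.
by rewrite ler_wpM2l ?subr_ge0// (le_trans (lerD (ler_norm c) (ler_norm c')))// lerDl.
Qed.

Lemma geometric_cvg0 : (fun n => - (2^-1 ^+ n) : R) @ \oo --> (0 : R).
Proof.
rewrite -[X in _ --> X]oppr0; apply: cvgN.
rewrite exprn_geometric; apply: cvg_geometric.
by rewrite ger0_norm ?invr_ge0// invf_lt1// ltr1n.
Qed.

End Completeness.

(** * The uniform boundedness principle *)

Section Baire.
Context {R : realType}.

Lemma linear_pack (V W : normedModType R[i]) (f : V -> W) :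
  linear f -> exists g : {linear V -> W}, f = g.
Proof.
move=> lf; pose g : {linear V -> W} := HB.pack f (GRing.isLinear.Build _ _ _ _ f lf).
by exists g.
Qed.

Variables (V : normedModType R[i]) (V_complete : majorant_complete V).

(** The Baire argument: a point common to nested balls on which P 0, P 1, ... hold.
    Halving the radii makes the centres a sequence majorized by minus the radii. *)
Lemma Baire_balls (P : nat -> V -> Prop) :
  (forall n x (r : R), 0 < r -> exists y, exists2 s : R, 0 < s &
     (forall z, rnorm (z - y) <= s -> rnorm (z - x) <= r /\ P n z)) ->
  exists z, forall n, P n z.
Proof.
move=> hP.
have step n (a : {xr : V * R | 0 < xr.2}) : exists b : {xr : V * R | 0 < xr.2},
    [/\ rnorm ((sval b).1 - (sval a).1) <= (sval a).2 - (sval b).2,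
      (sval b).2 <= 2^-1 * (sval a).2 &
      forall z, rnorm (z - (sval b).1) <= (sval b).2 -> P n z].
  move: a => -[[x r] /= r0].
  have r20 : 0 < r / 2 by rewrite divr_gt0.
  have [y [s s0 hs]] := hP n x _ r20.
  have s'0 : 0 < minr s (r / 2) by rewrite lt_min s0.
  exists (exist _ (y, minr s (r / 2)) s'0); split => /=.
  - have [|yx _] := hs y; first by rewrite subrr rnorm0 ltW.
    have : minr s (r / 2) <= r / 2 by rewrite ge_min lexx orbT.
    by move: yx; lra.
  - by rewrite ge_min [_^-1 * _]mulrC lexx orbT.
  - by move=> z zy; apply: (proj2 (hs z _)); rewrite (le_trans zy)// ge_min lexx.
have [f fP] := choice (fun na : nat * {xr : V * R | 0 < xr.2} => step na.1 na.2).
have r1 : 0 < ((0 : V), 1 : R).2 by [].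
pose s := fix s n := if n is m.+1 then f (m, s m) else exist _ ((0 : V), 1 : R) r1.
pose r n := (sval (s n)).2; pose x n := (sval (s n)).1.
have r_ge0 n : 0 <= r n by exact/ltW/(svalP (s n)).
have xP n : [/\ rnorm (x n.+1 - x n) <= r n - r n.+1, r n.+1 <= 2^-1 * r n &
    forall z, rnorm (z - x n.+1) <= r n.+1 -> P n z] by exact: (fP (n, s n)).
have rle n : r n <= 2^-1 ^+ n.
  elim: n => [|n IH]; first by rewrite expr0.
  by have [_ h _] := xP n; rewrite (le_trans h)// exprS ler_wpM2l// invr_ge0.
have rcvg : (fun n => - r n) @ \oo --> (0 : R).
  apply: (@squeeze_cvgr _ _ _ _ (fun n => - (2^-1 ^+ n) : R) (fun=> 0)).
  - by apply: nearW => k; rewrite lerN2 rle oppr_le0 r_ge0.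
  - exact: geometric_cvg0.
  - exact: cvg_cst.
have [l lP] : exists l, forall n, rnorm (l - x n) <= 0 - - r n.
  apply: (V_complete (u := x) (t := fun n => - r n)) => // n.
  by rewrite opprK [leRHS]addrC; have [] := xP n.
exists l => n; have [_ _] := xP n; apply.
by have := lP n.+1; rewrite opprK add0r.
Qed.

(** If no constant works, each ball contains a smaller one on which some T i is
    larger than n: T i is large at x + e or at x - e for a small e, and stays large
    nearby since T i is bounded.  A common point of these balls contradicts the
    pointwise bound. *)
Lemma uniform_boundedness (W : normedModType R[i]) (I : Type) (T : I -> V -> W) :
  (forall i, linear (T i)) -> (forall i, bounded (T i)) ->
  (forall x, exists K : R, forall i, rnorm (T i x) <= K) ->
  exists C : R, forall i x, rnorm (T i x) <= C * rnorm x.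
Proof.
move=> lT bT pT; apply: contrapT => /forallNP unb.
have TP i : exists S : {linear V -> W}, T i = S by exact: linear_pack.
suff [z zP] : exists z, forall n : nat, exists i, n%:R <= rnorm (T i z).
  have [K KP] := pT z; case: (zP (truncn K).+1) => i.
  by move=> /le_trans/(_ (KP i)); rewrite leNgt truncnS_gt.
apply: Baire_balls => n x r r0.
have TZ i k y : T i (k *: y) = k *: T i y by have [S ->] := TP i; rewrite linearZ.
have [i [e er Te]] : exists i, exists2 e, rnorm e <= r / 2 & n%:R + 1 <= rnorm (T i e).
  have /existsNP[i /existsNP[e /negP]] := unb (2 * (n%:R + 1) / r).
  rewrite -ltNge => Te; exists i.
  have e0 : 0 < rnorm e.
    apply: rnorm_gt0; apply/eqP => e0; move: Te.
    by rewrite e0; have [S ->] := TP i; rewrite linear0 !rnorm0 mulr0 ltxx.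
  exists ((r / 2 / rnorm e)%:C *: e).
    rewrite rnormZr ger0_norm; last by rewrite !divr_ge0// ltW.
    by rewrite divfK// gt_eqF.
  rewrite TZ rnormZr ger0_norm; last by rewrite !divr_ge0// ltW.
  rewrite mulrAC ler_pdivlMr//; move: Te => /ltW.
  rewrite mulrAC ler_pdivrMr//; lra.
have TB y z : T i (y - z) = T i y - T i z by have [S ->] := TP i; rewrite linearB.
have [x' xx' Tx'] : exists2 x', rnorm (x' - x) <= r / 2 & n%:R + 1 <= rnorm (T i x').
  have : rnorm (T i (x + e) - T i (x - e)) <= rnorm (T i (x + e)) + rnorm (T i (x - e)).
    exact: rnormB.
  rewrite -TB opprB addrC addrA subrK -mulr2n -scaler_nat TZ rnormZ.
  have -> : (2 : R[i]) = (2 : R)%:C by rewrite rmorphMn/= rmorph1.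
  rewrite rnorm_real ger0_norm// => h.
  have [xe|/ltW xe] := leP (n%:R + 1) (rnorm (T i (x + e))).
    by exists (x + e) => //; rewrite addrAC subrr add0r.
  exists (x - e); first by rewrite addrAC subrr add0r rnormN.
  by move: h xe Te; lra.
have [C C0 TC] := bounded_gt0 (bT i).
exists x', (minr (r / 2) C^-1); first by rewrite lt_min divr_gt0//= invr_gt0.
move=> z; rewrite le_min => /andP[zr zC]; split.
  rewrite -(subrK x' z) -addrA (le_trans (rnormD _ _))//.
  by move: zr xx'; lra.
exists i; have : rnorm (T i (z - x')) <= 1.
  rewrite (le_trans (TC _))// (le_trans (ler_wpM2l (ltW C0) zC))//.
  by rewrite mulfV// gt_eqF.
have : rnorm (T i x') <= rnorm (T i z) + rnorm (T i (z - x')).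
  by rewrite TB -{1}(subKr (T i z) (T i x')) rnormB.
by move: Tx'; lra.
Qed.

End Baire.

(** * Geometry of a Hilbert space *)

Section HilbertGeometry.
Context {R : realType} {H : hilbertType R}.
Implicit Types x y z : H.

Lemma innerC x y : inner x y = conjc (inner y x).
Proof. by rewrite (hermC inner) mul1r. Qed.

Lemma innerZl (a : R[i]) x y : inner (a *: x) y = a * inner x y.
Proof. by rewrite linearZl_LR. Qed.

Lemma innerZr (a : R[i]) x y : inner x (a *: y) = conjc a * inner x y.
Proof. by rewrite linearZr_LR. Qed.

Lemma innerDl x y z : inner (x + y) z = inner x z + inner y z.
Proof. by rewrite linearDl. Qed.

Lemma innerDr x y z : inner z (x + y) = inner z x + inner z y.
Proof. by rewrite linearDr. Qed.

Lemma innerNl x y : inner (- x) y = - inner x y.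
Proof. by rewrite linearNl. Qed.

Lemma innerNr x y : inner x (- y) = - inner x y.
Proof. by rewrite linearNr. Qed.

Lemma innerBl x y z : inner (x - y) z = inner x z - inner y z.
Proof. by rewrite innerDl innerNl. Qed.

Lemma innerBr x y z : inner z (x - y) = inner z x - inner z y.
Proof. by rewrite innerDr innerNr. Qed.

Lemma inner0l x : inner 0 x = 0.
Proof. by rewrite linear0l. Qed.

Lemma inner0r x : inner x 0 = 0.
Proof. by rewrite linear0r. Qed.

Lemma inner_rnorm x : inner x x = (rnorm x ^+ 2)%:C.
Proof. by rewrite -normr_inner -rnormE rmorphXn. Qed.

Lemma inner_eq0 x y : inner x y = 0 -> inner y x = 0.
Proof. by move=> xy; rewrite innerC xy rmorph0. Qed.

Lemma inner_ext x y : (forall z, inner x z = inner y z) -> x = y.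
Proof.
move=> xy; apply/eqP; rewrite -subr_eq0; apply/eqP/rnorm_le0.
have : inner (x - y) (x - y) = 0 by rewrite innerBl xy subrr.
by rewrite inner_rnorm => /complexI/eqP; rewrite expf_eq0/= => /eqP ->.
Qed.

(** Positivity of the norm of |y|^2 x - <x, y> y. *)
Lemma rnorm_inner x y : rnorm (inner x y : R[i]^o) <= rnorm x * rnorm y.
Proof.
have [->|y0] := eqVneq y 0; first by rewrite inner0r !rnorm0 mulr0.
have ny : 0 < rnorm y by exact: rnorm_gt0.
set a := inner x y; set b := rnorm y ^+ 2.
have b0 : 0 < b by rewrite exprn_gt0.
have aa : a * conjc a = (rnorm (a : R[i]^o) ^+ 2)%:C.
  by rewrite rmorphXn/= rnormE -sqr_normc.
have : 0 <= rnorm (b%:C *: x - a *: y) ^+ 2 by rewrite exprn_ge0// rnorm_ge0.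
rewrite -ler0c -inner_rnorm innerBl !innerBr !innerZl !innerZr -/a.
rewrite (innerC y x) -/a !inner_rnorm -/b conjc_real.
have -> : b%:C * (b%:C * (rnorm x ^+ 2)%:C) - b%:C * (conjc a * a) -
    (a * (b%:C * conjc a) - a * (conjc a * b%:C)) =
    b%:C * (b%:C * (rnorm x ^+ 2)%:C - a * conjc a) by ring.
rewrite aa -!real_complexM -rmorphB -real_complexM ler0c pmulr_rge0// subr_ge0.
by rewrite mulrC -exprMn ler_pXn2r// nnegrE ?mulr_ge0 ?rnorm_ge0.
Qed.

Lemma rnormD_sqr x y :
  rnorm (x + y) ^+ 2 = rnorm x ^+ 2 + rnorm y ^+ 2 + 2 * complex.Re (inner x y).
Proof.
apply: (@complexI R); rewrite -inner_rnorm innerDl !innerDr !inner_rnorm (innerC y x).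
rewrite !real_complexD; case: (inner x y) => u v; simpc.
by apply/eqP; rewrite eq_complex/=; apply/andP; split; apply/eqP; ring.
Qed.

Lemma rnormD_orth x y : inner x y = 0 ->
  rnorm (x + y) ^+ 2 = rnorm x ^+ 2 + rnorm y ^+ 2.
Proof. by move=> xy; rewrite rnormD_sqr xy/= mulr0 addr0. Qed.

Lemma parallelogram x y :
  rnorm (x + y) ^+ 2 + rnorm (x - y) ^+ 2 = 2 * rnorm x ^+ 2 + 2 * rnorm y ^+ 2.
Proof.
rewrite !rnormD_sqr rnormN innerNr; case: (inner x y) => u v /=; ring.
Qed.

Lemma hilbert_complete : majorant_complete H.
Proof. exact: complete_majorant. Qed.

End HilbertGeometry.

(** * Orthogonal projections and adjoints *)

Section Projections.
Context {R : realType}.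

Lemma real_complex1 : (1 : R)%:C = 1 :> R[i].
Proof. by []. Qed.

Lemma ler_of_sqr (a b : R) : 0 <= b -> a ^+ 2 <= b ^+ 2 -> a <= b.
Proof. by move=> b0 ab; rewrite leNgt; apply/negP => ba; nra. Qed.

(** Linear maps are built below by choosing values; this turns them into operators. *)
Lemma bounded_op_exists (V W : normedModType R[i]) (f : V -> W) :
  linear f -> bounded f -> exists g : bounded_op V W, g =1 f.
Proof.
move=> lf /bounded_gt0[C C0 fC].
have fP : f \in @bounded_linear R V W.
  apply/bounded_linearP; split => //; exists C; first exact: ltW.
  by move=> x; rewrite -rnorm_leP.
by exists (BoundedOp fP).
Qed.

Context {H : hilbertType R}.
Implicit Types (x y z : H) (S : set H).

(** Closedness is stated by approximation, to be combined with norm estimates. *)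
Definition closed_subspace S :=
  [/\ S 0, forall (a : R[i]) x y, S x -> S y -> S (a *: x + y) &
    forall x, (forall e : R, 0 < e -> exists2 y, S y & rnorm (x - y) <= e) -> S x].

Lemma geometric_small (e : R) : 0 < e -> exists n, 2^-1 ^+ n < e.
Proof.
move=> e0; have [N NP] := cvg_gap_small geometric_cvg0 e0.
by exists N; have := NP N (leqnn _); rewrite opprK add0r.
Qed.

(** The parallelogram law makes a minimizing sequence Cauchy. *)
Lemma closest_point S x : closed_subspace S ->
  exists2 y, S y & forall z, S z -> rnorm (x - y) <= rnorm (x - z).
Proof.
move=> [S0 Slin Scl].
pose D := [set rnorm (x - s) ^+ 2 | s in S].
have D_inf : has_inf D.
  split; first by exists (rnorm (x - 0) ^+ 2), 0.
  by exists 0 => _ [s _ <-]; rewrite exprn_ge0// rnorm_ge0.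
have dP z : S z -> inf D <= rnorm (x - z) ^+ 2.
  by move=> Sz; apply: ge_inf; [case: D_inf|exists z].
have d0 : 0 <= inf D.
  by apply: lb_le_inf; [case: D_inf|move=> _ [s _ <-]; rewrite exprn_ge0// rnorm_ge0].
have hp n : 0 < (2^-1 ^+ n : R) by rewrite exprn_gt0 ?invr_gt0.
have hS n : 2^-1 ^+ n.+1 = 2^-1 ^+ n / 2 :> R by rewrite exprS mulrC.
have /choice[s sP] : forall n, exists s, S s /\
    rnorm (x - s) ^+ 2 <= inf D + (2^-1 ^+ n.+2) ^+ 2.
  (* This error makes the n-th step of the sequence at most 2^-(n+1). *)
  move=> n; have e0 : 0 < (2^-1 ^+ n.+2 : R) ^+ 2 by rewrite exprn_gt0.
  by have [_ [s Ss <-] /ltW] := inf_adherent e0 D_inf; exists s.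
have [y yP] : exists y, forall n, rnorm (y - s n) <= 0 - - (2^-1 ^+ n).
  apply: hilbert_complete geometric_cvg0 => n.
  rewrite opprK [leRHS]addrC.
  have -> : 2^-1 ^+ n - 2^-1 ^+ n.+1 = 2^-1 ^+ n.+1 :> R by rewrite hS; lra.
  have := parallelogram (x - s n) (x - s n.+1).
  have -> : x - s n + (x - s n.+1) =
      (2 : R)%:C *: (x - (2^-1 : R)%:C *: (s n + s n.+1)).
    rewrite scalerBr scalerA -real_complexM mulfV ?pnatr_eq0// real_complex1 scale1r.
    by rewrite rmorphMn/= rmorph1 scaler_nat mulr2n addrACA opprD.
  have -> : x - s n - (x - s n.+1) = s n.+1 - s n.
    by rewrite opprB addrC addrA subrK.
  rewrite rnormZr exprMn ger0_norm//.
  have : inf D <= rnorm (x - (2^-1 : R)%:C *: (s n + s n.+1)) ^+ 2.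
    apply: dP; rewrite scalerDr.
    apply: (Slin); first by have [] := sP n.
    by rewrite -[X in S X]addr0; apply: (Slin) => //; have [] := sP n.+1.
  have [_] := sP n; have [_] := sP n.+1.
  move=> h1 h2 h3 h4; apply: ler_of_sqr; first exact: ltW.
  by move: h1 h2 h3 h4; rewrite !hS; have := hp n; nra.
have Sy : S y.
  apply: Scl => e /geometric_small[n /ltW ne]; exists (s n); first by have [] := sP n.
  by rewrite (le_trans (yP n))// opprK add0r.
exists y => // z /dP zd; apply/ler_addgt0Pr => e e0.
have [n ne] : exists n, 2^-1 ^+ n < e / 2 by apply: geometric_small; rewrite divr_gt0.
have h1 : rnorm (x - s n) <= rnorm (x - z) + 2^-1 ^+ n.
  apply: ler_of_sqr; first by rewrite addr_ge0 ?rnorm_ge0 ?ltW.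
  by have [_] := sP n; move: zd; rewrite !hS; have := hp n; have := rnorm_ge0 (x - z); nra.
have h2 : rnorm (x - y) <= rnorm (x - s n) + rnorm (y - s n).
  by have -> : x - y = (x - s n) - (y - s n); [rewrite opprB addrA subrK|exact: rnormB].
have := yP n; rewrite opprK add0r; lra.
Qed.

(** At the closest point y, removing from x - y its component along z in S cannot
    decrease the norm, so this component is zero. *)
Lemma orthogonal_decomposition S x : closed_subspace S ->
  exists2 y, S y & forall z, S z -> inner (x - y) z = 0.
Proof.
move=> Scs; have [y Sy ymin] := closest_point x Scs.
exists y => // z Sz; have [_ Slin _] := Scs.
have [->|z0] := eqVneq z 0; first by rewrite inner0r.
pose t := inner (x - y) z / inner z z.
have zz0 : inner z z != 0.
  rewrite inner_rnorm; apply/eqP => /complexI/eqP; rewrite expf_eq0/=.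
  by rewrite gt_eqF// rnorm_gt0.
have orth : inner (x - y - t *: z) z = 0.
  by rewrite innerBl innerZl divfK// subrr.
suff tz : t *: z = 0 by move: orth; rewrite tz subr0.
have ht : rnorm (x - y) ^+ 2 = rnorm (x - y - t *: z) ^+ 2 + rnorm (t *: z) ^+ 2.
  by rewrite -rnormD_orth ?subrK// innerZr orth mulr0.
have : rnorm (x - y) <= rnorm (x - y - t *: z).
  by rewrite -addrA -opprD; apply: ymin; rewrite addrC; exact: Slin.
rewrite -(@ler_pXn2r _ 2)// ?nnegrE ?rnorm_ge0// => h.
by apply/rnorm_le0/ler_of_sqr => //; rewrite expr0n/=; lra.
Qed.

Lemma orthogonal_decomposition_unique S x y y' : closed_subspace S ->
  S y -> (forall z, S z -> inner (x - y) z = 0) ->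
  S y' -> (forall z, S z -> inner (x - y') z = 0) -> y = y'.
Proof.
move=> [_ Slin _] Sy oy Sy' oy'.
have Sd : S (y - y') by rewrite addrC -scaleN1r; exact: Slin.
apply/eqP; rewrite -subr_eq0; apply/eqP/rnorm_le0.
have : inner (y - y') (y - y') = 0.
  by rewrite -{1}(subrK x y) -addrA innerDl oy'// -opprB innerNl oy// oppr0 addr0.
by rewrite inner_rnorm => /complexI/eqP; rewrite expf_eq0/= => /eqP ->.
Qed.

Definition is_projection_onto S (P : bounded_op H H) :=
  (forall x, S (P x)) /\ (forall x z, S z -> inner (x - P x) z = 0).

Lemma projection_exists S : closed_subspace S -> exists P, is_projection_onto S P.
Proof.
move=> Scs.
have /choice[p pP] : forall x, exists y, S y /\ forall z, S z -> inner (x - y) z = 0.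
  by move=> x; have [y Sy oy] := orthogonal_decomposition x Scs; exists y.
have [S0 Slin _] := Scs.
have uniq x y : S y -> (forall z, S z -> inner (x - y) z = 0) -> p x = y.
  by have [Sp op] := pP x; exact: (orthogonal_decomposition_unique Scs Sp op).
have lp : linear p.
  move=> a x y; apply: uniq; first by apply: Slin; [case: (pP x)|case: (pP y)].
  move=> z Sz; rewrite opprD addrACA -scalerBr innerDl innerZl.
  by rewrite (proj2 (pP x))// (proj2 (pP y))// mulr0 addr0.
have bp : bounded p.
  exists 1 => x; rewrite mul1r -(@ler_pXn2r _ 2)// ?nnegrE ?rnorm_ge0//.
  rewrite -{2}(subrK (p x) x) rnormD_orth; last exact: (proj2 (pP x)) (proj1 (pP x)).
  by rewrite lerDr exprn_ge0// rnorm_ge0.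
have [P PE] := bounded_op_exists lp bp.
by exists P; split=> [x|x z Sz]; rewrite PE; [case: (pP x)|exact: (proj2 (pP x))].
Qed.

(** A vector u orthogonal to the kernel of f represents f up to a scalar, because
    f(u) x - f(x) u lies in the kernel. *)
Lemma Riesz (f : H -> R[i]^o) : linear f -> bounded f ->
  exists w, forall x, f x = inner x w.
Proof.
move=> lf bf; have f0 : f 0 = 0.
  by have := lf (-1) 0 0; rewrite scaler0 add0r scaleN1r addNr.
have fZ a x : f (a *: x) = a * f x by have := lf a x 0; rewrite f0 !addr0.
have fB x y : f (x - y) = f x - f y.
  by rewrite addrC -scaleN1r lf scaleN1r addrC.
have [f_eq0|] := pselect (forall x, f x = 0).
  by exists 0 => x; rewrite inner0r.
move=> /existsNP[x0 /eqP fx0].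
have Kcs : closed_subspace [set x | f x = 0].
  split => [//|a x y /= fx fy|x xK /=].
    by rewrite lf fx fy addr0 scaler0.
  have [C C0 fC] := bounded_gt0 bf.
  apply: (@rnorm_lt_eps _ R[i]^o) => e e0.
  have [y /= fy xy] := xK (e / C) (divr_gt0 e0 C0).
  rewrite -[f x]subr0 -fy -fB (le_trans (fC _))//.
  by rewrite mulrC -ler_pdivlMr.
have [p /= fp op] := orthogonal_decomposition x0 Kcs.
pose u := x0 - p.
have fu : f u = f x0 by rewrite fB fp subr0.
have u0 : u != 0.
  by apply: contra_neq fx0 => u0; rewrite -fu u0 f0.
have uu0 : inner u u != 0.
  rewrite inner_rnorm; apply/eqP => /complexI/eqP; rewrite expf_eq0/=.
  by rewrite gt_eqF// rnorm_gt0.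
exists (conjc (f u / inner u u) *: u) => x.
have : inner u (f u *: x - f x *: u) = 0 by apply: op; rewrite /= fB !fZ; ring.
move=> /inner_eq0; rewrite innerBl !innerZl => /eqP; rewrite subr_eq0 => /eqP h.
by rewrite innerZr conjcK mulrAC h mulfK.
Qed.

Lemma adjoint_exists (b : bounded_op H H) : exists b', is_adjoint b b'.
Proof.
have /choice[c cP] : forall y, exists w, forall x, inner (b x) y = inner x w.
  move=> y; apply: (@Riesz (fun x => inner (b x) y)).
    by move=> a u v; rewrite linearP innerDl innerZl.
  exists (rnorm b * rnorm y) => x; rewrite (le_trans (rnorm_inner _ _))//.
  by rewrite mulrAC ler_wpM2r ?rnorm_ge0// rnorm_op.
have lc : linear c.
  move=> a u v; apply: inner_ext => z; rewrite innerC -cP (innerC (_ + _)); congr conjc.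
  by rewrite !innerDr !innerZr !cP.
have bc : bounded c.
  exists (rnorm b) => y; have [->|c0] := eqVneq (c y) 0.
    by rewrite rnorm0 mulr_ge0// rnorm_ge0.
  rewrite -(ler_pM2r (rnorm_gt0 c0)) -expr2.
  have -> : rnorm (c y) ^+ 2 = rnorm (inner (c y) (c y) : R[i]^o).
    by rewrite inner_rnorm rnorm_real ger0_norm// exprn_ge0// rnorm_ge0.
  rewrite -cP (le_trans (rnorm_inner _ _))// mulrAC ler_wpM2r ?rnorm_ge0//.
  exact: rnorm_op.
have [b' bE] := bounded_op_exists lc bc.
by exists b' => x y; rewrite bE cP.
Qed.

Section ProjectionTheory.
Variables (S : set H) (P : bounded_op H H).
Hypotheses (Scs : closed_subspace S) (SP : is_projection_onto S P).

Lemma projection_unique x y :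
  S y -> (forall z, S z -> inner (x - y) z = 0) -> P x = y.
Proof.
by have [SPx oP] := SP; exact: (orthogonal_decomposition_unique Scs (SPx x) (oP x)).
Qed.

Lemma projection_fix x : S x -> P x = x.
Proof.
by move=> Sx; apply: (projection_unique) => // z _; rewrite subrr inner0l.
Qed.

Lemma projection_mem x : S (P x).
Proof. exact: (proj1 SP). Qed.

Lemma projection_idem : P * P = P.
Proof. by apply: bounded_opP => x; apply/projection_fix/projection_mem. Qed.

Lemma projection_selfadj : is_adjoint P P.
Proof.
move=> x y; rewrite -{1}(subrK (P y) y) innerDr.
rewrite (inner_eq0 (proj2 SP _ _ (projection_mem x))) add0r.
rewrite -{2}(subrK (P x) x) innerDl.
by rewrite (proj2 SP _ _ (projection_mem y)) add0r.
Qed.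

(** If t and its adjoint preserve S, then t preserves both S and its orthogonal. *)
Lemma projection_comm (t t' : bounded_op H H) : is_adjoint t t' ->
  (forall x, S x -> S (t x)) -> (forall x, S x -> S (t' x)) -> P * t = t * P.
Proof.
move=> tt' St St'; apply: bounded_opP => x.
apply: (projection_unique); first exact/St/projection_mem.
move=> z Sz; rewrite -[(t * P) x]/(t (P x)) -linearB tt'.
by apply: (proj2 SP); exact: St'.
Qed.

End ProjectionTheory.
End Projections.

(** * The von Neumann algebra as a complete algebra of operators *)

Section VonNeumannBasics.
Context {R : realType} {H : hilbertType R} (M : vonNeumannAlgebra H).
Implicit Types (a b c e : M) (x y v w : H).

Lemma vna_ext a b : (forall x, a x = b x) -> a = b.
Proof. by move=> ab; apply/val_inj/bounded_opP. Qed.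

Lemma vna_scalerAl (k : R[i]) a b : k *: (a * b) = (k *: a) * b.
Proof. by apply: val_inj; exact: bounded_op_scaleAl. Qed.

Lemma vna_scalerAr (k : R[i]) a b : k *: (a * b) = a * (k *: b).
Proof. by apply: val_inj; exact: bounded_op_scaleAr. Qed.

Lemma rnorm_vna a x : rnorm (a x) <= rnorm a * rnorm x.
Proof. exact: rnorm_op. Qed.

Lemma rnorm_vna_le a (k : R) : 0 <= k ->
  (forall x, rnorm (a x) <= k * rnorm x) -> rnorm a <= k.
Proof. exact: rnorm_op_le. Qed.

Lemma rnormM a b : rnorm (a * b) <= rnorm a * rnorm b.
Proof.
by rewrite -lecR real_complexM !rnormE; exact: bounded_op_normM.
Qed.

Lemma commutantP (b : bounded_op H H) a x : commutant (vna_set M) b -> b (a x) = a (b x).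
Proof.
by move=> Mb; have /vna_memP/(_ b Mb) ba := valP a; rewrite -[LHS]/((b * val a) x) ba.
Qed.

Lemma vna_intro (p : bounded_op H H) :
  (forall q : bounded_op H H, commutant (vna_set M) q -> q * p = p * q) -> exists a, vna_val a = p.
Proof. by move=> /vna_memP Mp; exists (VnaElt Mp). Qed.

Lemma vna_adjoint a : exists a', is_adjoint a (vna_val a').
Proof.
have /set_mem/vna_star[b Mb ab] := valP a.
have Mb' : b \in vna_mem M by exact: mem_set.
by exists (VnaElt Mb').
Qed.

Lemma is_adjoint_sym (p q : bounded_op H H) : is_adjoint p q -> is_adjoint q p.
Proof. by move=> pq x y; rewrite innerC -pq -innerC. Qed.

(** Uses that the algebra itself is stable under adjoints. *)
Lemma commutant_adjoint (b b' : bounded_op H H) :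
  commutant (vna_set M) b -> is_adjoint b b' -> commutant (vna_set M) b'.
Proof.
move=> Mb bb' a0 /mem_set Ma; pose a : M := VnaElt Ma; have [a' aa'] := vna_adjoint a.
apply: bounded_opP => x; apply: inner_ext => y.
rewrite -[LHS]/(inner (a (b' x)) y) -[RHS]/(inner (b' (a x)) y).
by rewrite aa' (is_adjoint_sym bb') (commutantP _ _ Mb) -aa' (is_adjoint_sym bb').
Qed.

(** Limits are taken vector by vector; the limit operator commutes with the
    commutant, hence lies in the algebra by the bicommutant property. *)
Lemma vna_complete : majorant_complete M.
Proof.
move=> u t B ut tB; have tle := majorant_le ut tB.
have /choice[L LP] : forall x, exists l, forall n, rnorm (l - u n x) <= (B - t n) * rnorm x.
  move=> x; have [l lP] : exists l, forall n,
      rnorm (l - u n x) <= B * rnorm x - t n * rnorm x.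
    apply: (hilbert_complete (u := fun n => u n x)); last by apply: cvgM => //; exact: cvg_cst.
    move=> n; rewrite -mulrBl.
    by rewrite (le_trans (rnorm_vna (u n.+1 - u n) x))// ler_wpM2r ?rnorm_ge0.
  by exists l => n; rewrite mulrBl.
have Llin : linear L.
  move=> k x y.
  apply: (majorant_limit_unique (u := fun n => u n (k *: x + y)) (c := rnorm (k *: x + y))
    (c' := rnorm (k : R[i]^o) * rnorm x + rnorm y) tle tB) => // n.
  rewrite linearP opprD addrACA -scalerBr (le_trans (rnormD _ _))//.
  rewrite mulrDr lerD ?LP// rnormZ mulrCA ler_wpM2l ?rnorm_ge0//; exact: LP.
have Lb : bounded L.
  exists (B - t 0%N + rnorm (u 0%N)) => x.
  rewrite -(subrK (u 0%N x) (L x)) (le_trans (rnormD _ _))// mulrDl lerD//.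
  exact: rnorm_vna.
have [p pE] := bounded_op_exists Llin Lb.
have [l lE] : exists l : M, vna_val l = p.
  apply: vna_intro => q Mq; apply: bounded_opP => x.
  rewrite -[LHS]/(q (p x)) -[RHS]/(p (q x)) !pE.
  apply: (majorant_limit_unique (u := fun n => u n (q x)) (c := rnorm q * rnorm x)
    (c' := rnorm (q x)) tle tB) => // n.
  rewrite -commutantP// -linearB (le_trans (rnorm_op _ _))// mulrCA.
  by rewrite ler_wpM2l ?rnorm_ge0.
exists l => n; apply: rnorm_vna_le => [|x]; first by rewrite subr_ge0.
by rewrite -[X in rnorm X]/(l x - u n x) lE pE.
Qed.

End VonNeumannBasics.

(** * Projections and square roots in a von Neumann algebra *)

Section VonNeumannProjections.
Context {R : realType} {H : hilbertType R} (M : vonNeumannAlgebra H).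
Implicit Types (a b c e r : M) (x y v w : H).

Definition selfadjoint a := is_adjoint a a.

Definition projection e := selfadjoint e /\ e * e = e.

Lemma projection0 : projection 0.
Proof.
split=> [x y|]; last by rewrite mulr0.
by rewrite -[RHS]/(inner x 0) -[LHS]/(inner 0 y) inner0l inner0r.
Qed.

Lemma projection1 : projection 1.
Proof. by split=> [x y|]; last rewrite mulr1. Qed.

Lemma selfadjointD a b : selfadjoint a -> selfadjoint b -> selfadjoint (a + b).
Proof.
move=> sa sb x y; rewrite -[LHS]/(inner (a x + b x) y) -[RHS]/(inner x (a y + b y)).
by rewrite innerDl innerDr sa sb.
Qed.

Lemma selfadjointZ (k : R) a : selfadjoint a -> selfadjoint (k%:C *: a).
Proof.
move=> sa x y; rewrite -[LHS]/(inner (k%:C *: a x) y) -[RHS]/(inner x (k%:C *: a y)).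
by rewrite innerZl innerZr sa conjc_real.
Qed.

Lemma selfadjointN a : selfadjoint a -> selfadjoint (- a).
Proof.
move=> sa x y; rewrite -[LHS]/(inner (- a x) y) -[RHS]/(inner x (- a y)).
by rewrite innerNl innerNr sa.
Qed.

Lemma selfadjointB a b : selfadjoint a -> selfadjoint b -> selfadjoint (a - b).
Proof. by move=> sa sb; apply: selfadjointD => //; exact: selfadjointN. Qed.

Lemma selfadjoint_sqr a : selfadjoint a -> selfadjoint (a * a).
Proof.
by move=> sa x y; rewrite -[LHS]/(inner (a (a x)) y) -[RHS]/(inner x (a (a y))) !sa.
Qed.

Lemma projection_comp e : projection e -> projection (1 - e).
Proof.
move=> [se ee]; split; first exact: selfadjointB (proj1 projection1) se.
by rewrite mulrBl mul1r mulrBr mulr1 ee subrr subr0.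
Qed.

Lemma projectionK e x : projection e -> e (e x) = e x.
Proof. by move=> [_ ee]; rewrite -[LHS]/((e * e) x) ee. Qed.

Lemma projection_pythagoras e x : projection e ->
  rnorm x ^+ 2 = rnorm (e x) ^+ 2 + rnorm (x - e x) ^+ 2.
Proof.
move=> pe; have [se _] := pe; rewrite -rnormD_orth; last first.
  by rewrite se linearB/= projectionK// subrr inner0r.
by rewrite addrC subrK.
Qed.

Lemma rnorm_projection e x : projection e -> rnorm (e x) <= rnorm x.
Proof.
move=> pe; apply: ler_of_sqr; first exact: rnorm_ge0.
by rewrite (projection_pythagoras x pe) lerDl exprn_ge0// rnorm_ge0.
Qed.

Lemma rnorm_projection_le1 e : projection e -> rnorm e <= 1.
Proof. by move=> pe; apply: rnorm_vna_le => // x; rewrite mul1r rnorm_projection. Qed.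

(** Taking adjoints in c a = a c. *)
Lemma selfadjoint_adjoint_comm a c c' : selfadjoint a -> is_adjoint c (vna_val c') ->
  c * a = a * c -> c' * a = a * c'.
Proof.
move=> sa cc' ca; apply: vna_ext => x; apply: inner_ext => y.
rewrite -[LHS]/(inner (c' (a x)) y) -[RHS]/(inner (a (c' x)) y) sa.
rewrite !(is_adjoint_sym cc') sa.
by rewrite -[a (c y)]/((a * c) y) -ca.
Qed.

(** The commutant is stable under adjoints, so the projection onto an invariant
    subspace commutes with it and lies in the bicommutant. *)
Lemma invariant_projection (S : set H) : closed_subspace S ->
  (forall b : bounded_op H H, commutant (vna_set M) b -> forall x, S x -> S (b x)) ->
  exists e : M, projection e /\ is_projection_onto S e.
Proof.
move=> Scs Sinv; have [P SP] := projection_exists Scs.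
have [e eP] : exists e : M, vna_val e = P.
  apply: vna_intro => q Mq; have [q' qq'] := adjoint_exists q.
  have Mq' := commutant_adjoint Mq qq'.
  by apply/esym/(projection_comm Scs SP qq'); exact: Sinv.
exists e; rewrite /projection /selfadjoint eP; split; last by [].
split; first exact: (projection_selfadj SP).
by apply: val_inj; rewrite /= eP; exact: (projection_idem Scs SP).
Qed.

Lemma kernel_closed_subspace a : closed_subspace [set x | a x = 0].
Proof.
split=> [|k x y /= ax ay|x ax /=]; first exact: linear0.
  by rewrite linearP/= ax ay scaler0 addr0.
apply: rnorm_lt_eps => e e0.
have K0 : 0 < rnorm a + 1 by rewrite ltr_wpDl// rnorm_ge0.
have [y /= ay xy] := ax _ (divr_gt0 e0 K0).
rewrite -[a x]subr0 -ay -linearB (le_trans (rnorm_vna _ _))//.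
move: xy; rewrite ler_pdivlMr// mulrC; apply: le_trans.
by rewrite ler_wpM2r ?rnorm_ge0// lerDl.
Qed.

(** Stated for additive maps so as to apply both to commutation with an element and to
    self-adjointness, which is not a complex linear condition. *)
Lemma bounded_kernel_closed (V : normedModType R[i]) (T : M -> V) (u : nat -> M)
    (t : nat -> R) (B : R) l :
  (forall a b, T (a - b) = T a - T b) -> bounded T ->
  t @ \oo --> B -> (forall n, rnorm (l - u n) <= B - t n) ->
  (forall n, T (u n) = 0) -> T l = 0.
Proof.
move=> TB /bounded_gt0[C C0 TC] tB lu Tu; apply: rnorm_lt_eps => e e0.
have [n nP] := cvg_gap_small tB (divr_gt0 e0 C0).
rewrite -[T l]subr0 -(Tu n) -TB (le_trans (TC _))// mulrC -ler_pdivlMr//.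
by rewrite (le_trans (lu n))// ltW// nP.
Qed.

(** Iterating y |-> (a + y^2) / 2 from 0 is dominated by the scalar iteration
    t |-> (1 + t^2) / 2, which increases and stays below 1.  The limit y gives a
    square root 1 - y of 1 - a. *)
Lemma sqrt_fixpoint a : rnorm a <= 1 -> exists y : M,
  [/\ rnorm y <= 1, y = (2^-1 : R)%:C *: (a + y * y),
    forall c, c * a = a * c -> c * y = y * c & selfadjoint a -> selfadjoint y].
Proof.
move=> a1; have half_ge0 : (0 : R) <= 2^-1 by rewrite invr_ge0.
pose t := fix t n : R := if n is m.+1 then 2^-1 * (1 + t m ^+ 2) else 0.
pose u := fix u n : M := if n is m.+1 then (2^-1 : R)%:C *: (a + u m * u m) else 0.
have uS n : u n.+1 = (2^-1 : R)%:C *: (a + u n * u n) by [].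
have tS n : t n.+1 = 2^-1 * (1 + t n ^+ 2) by [].
have t_ge0 n : 0 <= t n.
  by elim: n => [//|n IH] /=; rewrite mulr_ge0 ?invr_ge0 ?addr_ge0 ?exprn_ge0.
have t_le1 n : t n <= 1.
  by elim: n => [//|n IH] /=; have := t_ge0 n; nra.
have t_nd n : t n <= t n.+1 by have := t_le1 n; rewrite /=; nra.
have uZ z : rnorm ((2^-1 : R)%:C *: z : M) = 2^-1 * rnorm z.
  by rewrite rnormZr ger0_norm.
have ut n : rnorm (u n) <= t n.
  elim: n => [|n IH]; first by rewrite rnorm0.
  rewrite /= uZ ler_wpM2l// (le_trans (rnormD _ _))// lerD// (le_trans (rnormM _ _))//.
  by rewrite expr2 ler_pM ?rnorm_ge0.
have du n : rnorm (u n.+1 - u n) <= t n.+1 - t n.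
  elim: n => [|n IH].
    rewrite /= mulr0 addr0 expr0n/= addr0 !subr0 uZ mulr1.
    by rewrite -[leRHS]mulr1 ler_wpM2l.
  rewrite (uS n.+1) {3}(uS n) -scalerBr uZ opprD addrACA subrr add0r.
  have -> : u n.+1 * u n.+1 - u n * u n =
      u n.+1 * (u n.+1 - u n) + (u n.+1 - u n) * u n.
    by rewrite mulrBr mulrBl addrA subrK.
  have h1 : rnorm (u n.+1 * (u n.+1 - u n)) <= t n.+1 * (t n.+1 - t n).
    by rewrite (le_trans (rnormM _ _))// ler_pM ?rnorm_ge0.
  have h2 : rnorm ((u n.+1 - u n) * u n) <= (t n.+1 - t n) * t n.
    by rewrite (le_trans (rnormM _ _))// ler_pM ?rnorm_ge0.
  have -> : t n.+2 - t n.+1 = 2^-1 * (t n.+1 * (t n.+1 - t n) + (t n.+1 - t n) * t n).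
    by rewrite (tS n.+1) {2}(tS n); ring.
  by rewrite ler_wpM2l// (le_trans (rnormD _ _))// lerD.
have [B tB] : exists B : R, t @ \oo --> B.
  suff /cvg_ex[B tB] : cvgn t by exists B.
  apply: nondecreasing_is_cvgn; first exact/nondecreasing_seqP.
  by exists 1 => _ [n _ <-].
have B1 : B <= 1.
  rewrite -(cvg_lim (@Rhausdorff R) tB); apply: limr_le.
    by apply/cvg_ex; exists B.
  by apply: nearW => n; exact: t_le1.
have [y yu] := @vna_complete _ _ M u t B du tB.
have y1 : rnorm y <= 1.
  by have := yu 0%N; rewrite /= !subr0 => /le_trans; apply.
exists y; split => //.
- apply/eqP; rewrite -subr_eq0; apply/eqP/rnorm_lt_eps => e e0.
  have e20 : 0 < e / 2 by rewrite divr_gt0.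
  have [n nP] := cvg_gap_small tB e20.
  have yn : rnorm (y - u n) <= e / 2 by rewrite (le_trans (yu n))// ltW// nP.
  have yn1 : rnorm (y - u n.+1) <= e / 2.
    by rewrite (le_trans (yu _))// ltW// nP// leqnSn.
  have -> : y - (2^-1 : R)%:C *: (a + y * y) =
      (y - u n.+1) - (2^-1 : R)%:C *: (y * (y - u n) + (y - u n) * u n).
    rewrite mulrBr mulrBl addrA subrK uS.
    rewrite -addrA -opprD -scalerDr; congr (_ - _ *: _).
    by rewrite -addrA [u n * u n + _]addrC subrK.
  rewrite (le_trans (rnormB _ _))// uZ.
  have h1 : rnorm (y * (y - u n)) <= 1 * (e / 2).
    by rewrite (le_trans (rnormM _ _))// ler_pM ?rnorm_ge0.
  have h2 : rnorm ((y - u n) * u n) <= (e / 2) * 1.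
    by rewrite (le_trans (rnormM _ _))// ler_pM ?rnorm_ge0// (le_trans (ut n)).
  have := rnormD (y * (y - u n)) ((y - u n) * u n); lra.
- move=> c ca; apply/eqP; rewrite -subr_eq0; apply/eqP.
  apply: (bounded_kernel_closed (T := fun z => c * z - z * c) _ _ tB yu).
  + by move=> z z'; rewrite mulrBr mulrBl !opprD !opprK addrACA.
  + exists (rnorm c + rnorm c) => z; rewrite (le_trans (rnormB _ _))// mulrDl.
    by rewrite lerD// ?rnormM// (le_trans (rnormM _ _))// mulrC.
  + move=> n; apply/eqP; rewrite subr_eq0; apply/eqP.
    elim: n => [|n IH]; first by rewrite mulr0 mul0r.
    by rewrite /= -vna_scalerAr -vna_scalerAl mulrDr mulrDl ca mulrA IH -!mulrA IH.
- move=> sa x z; apply/eqP; rewrite -subr_eq0; apply/eqP.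
  apply: (bounded_kernel_closed (V := R[i]^o)
    (T := fun s : M => inner (s x) z - inner x (s z)) _ _ tB yu).
  + move=> s s'; rewrite -[LHS]/(inner (s x - s' x) z - inner x (s z - s' z)).
    by rewrite innerBl innerBr !opprD !opprK addrACA.
  + exists (rnorm x * rnorm z + rnorm x * rnorm z) => s; rewrite mulrDl.
    rewrite (le_trans (rnormB _ _))// lerD// (le_trans (rnorm_inner _ _))//.
      by rewrite [leRHS]mulrC mulrA ler_wpM2r ?rnorm_ge0// rnorm_vna.
    by rewrite -mulrA ler_wpM2l ?rnorm_ge0// [leRHS]mulrC rnorm_vna.
  + move=> n /=; suff -> : selfadjoint (u n) by rewrite subrr.
    elim: n => [|n IH]; first exact: (proj1 projection0).
    by apply/selfadjointZ/selfadjointD => //; exact: selfadjoint_sqr.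
Qed.

End VonNeumannProjections.

(** * Norm density of the span of the projections *)

Section SpectralApproximation.
Context {R : realType} {H : hilbertType R} (M : vonNeumannAlgebra H).
Implicit Types (a b c e r : M) (x y v w : H).

Lemma double_half : 2%:R * (2^-1 : R)%:C = 1 :> R[i].
Proof.
have -> : 2%:R = (2%:R : R)%:C :> R[i] by rewrite rmorphMn/= rmorph1.
by rewrite -real_complexM mulfV ?pnatr_eq0// real_complex1.
Qed.

Lemma rnormB_sqr x y :
  rnorm (x - y) ^+ 2 = rnorm x ^+ 2 + rnorm y ^+ 2 - 2 * complex.Re (inner x y).
Proof. by rewrite rnormD_sqr rnormN innerNr; case: (inner x y) => s t /=; ring. Qed.

Lemma inner_sqr a x : selfadjoint a -> inner ((a * a) x) x = (rnorm (a x) ^+ 2)%:C.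
Proof. by move=> sa; rewrite -inner_rnorm -[(a * a) x]/(a (a x)) sa. Qed.

(** A square root of 1 - (1 - a^2), obtained from [sqrt_fixpoint].  The bound on
    1 - r replaces positivity of r in what follows. *)
Lemma absolute_value a : selfadjoint a -> rnorm a <= 1 -> exists r,
  [/\ selfadjoint r, r * r = a * a, rnorm (1 - r) <= 1 &
    forall c, c * a = a * c -> c * r = r * c].
Proof.
move=> sa a1; have sx : selfadjoint (1 - a * a).
  by apply: selfadjointB; [exact: (proj1 (projection1 M))|exact: selfadjoint_sqr].
have x1 : rnorm (1 - a * a) <= 1.
  apply: rnorm_vna_le => // v; rewrite mul1r; apply: ler_of_sqr; first exact: rnorm_ge0.
  rewrite -[(1 - a * a) v]/(v - a (a v)) rnormB_sqr -sa inner_rnorm/=.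
  have : rnorm (a (a v)) <= rnorm (a v).
    by rewrite (le_trans (rnorm_vna _ _))// ler_piMl// rnorm_ge0.
  by have := rnorm_ge0 (a (a v)); have := rnorm_ge0 (a v); nra.
have [y [y1 yE yc ys]] := sqrt_fixpoint x1.
exists (1 - y); split.
- by apply: selfadjointB; [exact: (proj1 (projection1 M))|exact: ys].
- have y2 : y + y = 1 - a * a + y * y.
    by rewrite -mulr2n -scaler_nat {1}yE scalerA double_half scale1r.
  have -> : (1 - y) * (1 - y) = 1 + y * y - (y + y).
    by rewrite mulrBl mul1r mulrBr mulr1 opprB addrACA -opprD.
  by rewrite y2 opprD addrACA subrr addr0 subKr.
- by rewrite opprB addrC subrK.
- move=> c ca; rewrite mulrBr mulrBl mulr1 mul1r yc//.
  by rewrite mulrBr mulrBl mulr1 mul1r mulrA ca -!mulrA ca.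
Qed.

(** Let e be the projection on the kernel of r - a, with r as in [absolute_value].
    As (r - a) (r + a) = 0, one has a = r on the range of e and a = - r on its
    orthogonal, so a - (2 e - 1) / 2 has on each vector the norm of r - 1 / 2.
    Finally |r v - v| <= |v| gives 2 Re <r v, v> >= |r v|^2, whence
    |r v - v / 2|^2 <= 3 / 4 |v|^2, and 3 / 4 <= (7 / 8)^2. *)
Lemma spectral_step a : selfadjoint a -> rnorm a <= 1 -> exists e,
  [/\ projection e, forall c, c * a = a * c -> c * e = e * c &
    rnorm (a - e + (2^-1 : R)%:C *: (1 : M)) <= 7%:R / 8%:R].
Proof.
move=> sa a1; have [r [sr rra r1 rc]] := absolute_value sa a1.
have ra := rc a erefl.
have rE v : rnorm (r v) = rnorm (a v).
  apply/eqP; rewrite -(@eqrXn2 _ 2) ?rnorm_ge0//; apply/eqP/(@complexI R).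
  by rewrite -!inner_sqr// rra.
have Scs := kernel_closed_subspace (r - a).
have SE v : [set x | (r - a) x = 0] v <-> r v = a v.
  rewrite -[X in X <-> _]/(r v - a v = 0).
  by split => [/eqP|->]; [rewrite subr_eq0 => /eqP|rewrite subrr].
have [e [pe eS]] : exists e : M, projection e /\ is_projection_onto [set x | (r - a) x = 0] e.
  apply: invariant_projection => // b Mb x /SE rx; apply/SE.
  by rewrite -!(commutantP _ _ Mb) rx.
have ec c : c * a = a * c -> c * e = e * c.
  move=> ca; have [c' cc'] := vna_adjoint c.
  have c'a := selfadjoint_adjoint_comm sa cc' ca.
  have inv d : d * a = a * d -> forall x, [set x | (r - a) x = 0] x ->
      [set x | (r - a) x = 0] (d x).
    move=> da x /SE rx; apply/SE.
    by rewrite -[r (d x)]/((r * d) x) -[a (d x)]/((a * d) x) -da -(rc _ da) /= rx.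
  by apply/esym/val_inj; exact: (projection_comm Scs eS cc' (inv _ ca) (inv _ c'a)).
exists e; split => //.
have ea := ec a erefl; have er : r * e = e * r by apply: ec; rewrite ra.
have eraE v : e (r v) = e (a v).
  rewrite -[e (r v)]/((e * r) v) -[e (a v)]/((e * a) v) -er -ea.
  by apply/SE; exact: (projection_mem eS).
have eraN v : r v + a v = e (r v + a v).
  apply/esym/(projection_fix Scs eS)/SE.
  rewrite !linearD/= -[r (r v)]/((r * r) v) rra -[r (a v)]/((r * a) v) -ra addrC.
  by [].
have h0 : (0 : R) <= 7%:R / 8%:R by rewrite divr_ge0.
apply: rnorm_vna_le => // v.
set b := a - e + _; pose h : R[i] := (2^-1 : R)%:C; pose w := r v - h *: v.
have bE : b v = a v - e v + h *: v by [].
have two0 : 2%:R != 0 :> R[i] by rewrite pnatr_eq0.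
have hE : h = 2%:R^-1 by apply: (mulfI two0); rewrite double_half mulfV.
have eb : e (b v) = e w.
  rewrite bE /w linearD !linearB !linearZ/= projectionK// eraE.
  by apply: inner_ext => z; rewrite !(innerDl, innerBl, innerZl, innerNl) hE; field.
have neb : b v - e (b v) = - (w - e w).
  have av : a v = e (r v) + e (r v) - r v.
    by have := eraN v; rewrite linearD/= -eraE => <-; rewrite addrAC subrr add0r.
  rewrite eb bE /w linearB linearZ/= av.
  by apply: inner_ext => z; rewrite !(innerDl, innerBl, innerZl, innerNl) hE; field.
have bw : rnorm (b v) = rnorm w.
  apply/eqP; rewrite -(@eqrXn2 _ 2) ?rnorm_ge0//; apply/eqP.
  by rewrite (projection_pythagoras (b v) pe) (projection_pythagoras w pe) neb rnormN eb.
rewrite bw; apply: ler_of_sqr; first by rewrite mulr_ge0// rnorm_ge0.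
have := rnorm_vna (1 - r) v; rewrite -[(1 - r) v]/(v - r v).
move=> /le_trans/(_ (ler_wpM2r (rnorm_ge0 v) r1)); rewrite mul1r => hv.
have := rnorm_vna a v => /le_trans/(_ (ler_wpM2r (rnorm_ge0 v) a1)); rewrite mul1r -rE.
have : rnorm (v - r v) ^+ 2 <= rnorm v ^+ 2 by rewrite ler_pXn2r ?nnegrE ?rnorm_ge0.
rewrite /w !rnormB_sqr innerZr conjc_real rnormZr ger0_norm ?invr_ge0//.
rewrite (innerC v); case: (inner (r v) v) => s t /=.
have := rnorm_ge0 (r v); have := rnorm_ge0 v.
by nra.
Qed.

(** Only projections commuting with everything that commutes with a are tested:
    in a corner p M p these are the ones that can be compared with p.  Each use of
    [spectral_step] improves the bound on T by the factor 7 / 8. *)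
Lemma vanish_selfadjoint (V : normedModType R[i]) (T : M -> V) a :
  linear T -> bounded T -> selfadjoint a ->
  (forall e, projection e -> (forall c, c * a = a * c -> c * e = e * c) -> T e = 0) ->
  T a = 0.
Proof.
move=> /linear_pack[{}T ->] /bounded_gt0[C C0 TC] sa Te.
have T1 : T 1 = 0.
  by apply: Te; [exact: projection1|move=> c _; rewrite mulr1 mul1r].
have q0 : (0 : R) <= 7%:R / 8%:R by lra.
pose good b := selfadjoint b /\ forall c, c * a = a * c -> c * b = b * c.
suff hK : forall n b, good b -> rnorm (T b) <= C * (7%:R / 8%:R) ^+ n * rnorm b.
  have ga : good a by [].
  apply: rnorm_lt_eps => eps eps0.
  have q : `|7%:R / 8%:R : R| < 1 by rewrite ger0_norm; lra.
  have K0 : 0 < C * rnorm a + 1 by rewrite ltr_wpDl// mulr_ge0 ?rnorm_ge0// ltW.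
  have /cvgrPdist_lt/(_ _ (divr_gt0 eps0 K0))[N _ NP] := @cvg_geometric R 1 _ q.
  have := NP N (leqnn N); rewrite /= sub0r normrN mul1r ger0_norm ?exprn_ge0//.
  rewrite ltr_pdivlMr// => /ltW; apply: le_trans.
  rewrite (le_trans (hK N a ga))// mulrAC [leLHS]mulrC ler_wpM2l ?lerDl//.
  by rewrite exprn_ge0.
elim=> [|n IH] b [sb bc]; first by rewrite expr0 mulr1.
have [->|b0] := eqVneq b 0; first by rewrite linear0 !rnorm0 mulr0.
have nb := rnorm_gt0 b0.
pose b1 := ((rnorm b)^-1)%:C *: b.
have sb1 : selfadjoint b1 by exact: selfadjointZ.
have b1c c : c * a = a * c -> c * b1 = b1 * c.
  by move=> ca; rewrite -vna_scalerAr -vna_scalerAl bc.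
have nb1 : rnorm b1 <= 1.
  by rewrite rnormZr ger0_norm ?invr_ge0 ?(ltW nb)// mulVf// gt_eqF.
have [e [pe ec en]] := spectral_step sb1 nb1.
have Te0 : T e = 0 by apply: Te => // c ca; apply/ec/b1c.
have : rnorm (T b1) <= C * (7%:R / 8%:R) ^+ n.+1.
  have -> : T b1 = T (b1 - e + (2^-1 : R)%:C *: (1 : M)).
    have -> : b1 - e + (2^-1 : R)%:C *: (1 : M) =
        (2^-1 : R)%:C *: (1 : M) + (b1 - e) by rewrite addrC.
    by rewrite linearP linearB/= T1 Te0 scaler0 add0r subr0.
  rewrite (le_trans (IH _ _))//; last first.
    by rewrite exprSr (mulrA C) ler_wpM2l// mulr_ge0 ?exprn_ge0// ltW.
  split.
    apply: selfadjointD; first by apply: selfadjointB; case: pe.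
    by apply: selfadjointZ; case: (projection1 M).
  move=> c ca; rewrite mulrDr mulrBr mulrDl mulrBl b1c// ec//; last exact: b1c.
  by rewrite -vna_scalerAr -vna_scalerAl mulr1 mul1r.
rewrite linearZ/= rnormZr ger0_norm ?invr_ge0 ?(ltW nb)//.
by rewrite mulrC ler_pdivrMr.
Qed.

Lemma vanish_on_projections (V : normedModType R[i]) (T : M -> V) :
  linear T -> bounded T -> (forall e, projection e -> T e = 0) -> forall a, T a = 0.
Proof.
move=> lT bT Te; have Ts a : selfadjoint a -> T a = 0.
  by move=> sa; apply: vanish_selfadjoint => // e pe _; exact: Te.
have [S TE] := linear_pack lT; rewrite TE in Ts *.
move=> a; have [a' aa'] := vna_adjoint a; have a'a := is_adjoint_sym aa'.
have s1 : selfadjoint (a + a').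
  move=> x y; rewrite -[LHS]/(inner (a x + a' x) y) -[RHS]/(inner x (a y + a' y)).
  by rewrite innerDl innerDr aa' a'a addrC.
pose i : R[i] := 0 +i* 1.
have ic : conjc i = - i by rewrite /i; simpc.
have s2 : selfadjoint (i *: (a - a')).
  move=> x y; rewrite -[LHS]/(inner (i *: (a x - a' x)) y).
  rewrite -[RHS]/(inner x (i *: (a y - a' y))) innerZl innerZr innerBl innerBr aa' a'a ic.
  by rewrite mulNr -mulrN opprB.
have S1 : S a + S a' = 0 by rewrite -linearD Ts.
have S2 : S a - S a' = 0.
  apply/eqP; have /eqP := Ts _ s2; rewrite linearZ/= linearB scaler_eq0 => /orP[|//].
  by rewrite /i eq_complex/= oner_eq0 andbF.
have : S a *+ 2 = 0.
  have -> : S a *+ 2 = (S a + S a') + (S a - S a') by rewrite addrACA subrr addr0.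
  by rewrite S1 S2 addr0.
move=> /eqP; rewrite -scaler_nat scaler_eq0 pnatr_eq0/= => /eqP; exact.
Qed.

End SpectralApproximation.

(** * Central and minimal projections *)

Section CentralProjections.
Context {R : realType} {H : hilbertType R} (M : vonNeumannAlgebra H).
Implicit Types (a b c e p q : M) (x y v w : H).

Lemma bounded_mull a : bounded (fun z : M => a * z).
Proof. by exists (rnorm a) => z; exact: rnormM. Qed.

Lemma bounded_mulr a : bounded (fun z : M => z * a).
Proof. by exists (rnorm a) => z; rewrite mulrC rnormM. Qed.

Lemma central_of_projections c :
  (forall e, projection e -> c * e = e * c) -> forall a, c * a = a * c.
Proof.
move=> ce a; apply/eqP; rewrite -subr_eq0; apply/eqP.
apply: (vanish_on_projections (T := fun z : M => c * z - z * c)).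
- move=> k z z'; rewrite mulrDr mulrDl -vna_scalerAr -vna_scalerAl.
  by rewrite opprD addrACA -scalerBr.
- apply: boundedD; first exact: bounded_mull.
  exact/boundedN/bounded_mulr.
- by move=> e /ce ->; rewrite subrr.
Qed.

Lemma central_projection (S : set H) : closed_subspace S ->
  (forall b : bounded_op H H, commutant (vna_set M) b -> forall x, S x -> S (b x)) ->
  (forall e, projection e -> forall x, S x -> S (e x)) ->
  exists c : M, [/\ projection c, is_projection_onto S c & forall a, c * a = a * c].
Proof.
move=> Scs Sinv Se; have [c [pc cS]] := invariant_projection Scs Sinv.
exists c; split => //; apply: central_of_projections => e pe; apply: val_inj.
by apply: (projection_comm Scs cS (proj1 pe)); exact: Se.
Qed.

Lemma subprojection_comm p q : projection p -> projection q -> p * q = q -> q * p = q.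
Proof.
move=> [sp _] [sq _] pq; apply: vna_ext => x; apply: inner_ext => y.
by rewrite -[LHS]/(inner (q (p x)) y) sq sp -[p (q y)]/((p * q) y) pq -sq.
Qed.

Lemma projection_sub p q : projection p -> projection q -> p * q = q ->
  projection (p - q).
Proof.
move=> pp pq ppq; split; first exact: selfadjointB (proj1 pp) (proj1 pq).
rewrite mulrBl !mulrBr ppq (subprojection_comm pp pq ppq) (proj2 pp) (proj2 pq).
by rewrite subrr subr0.
Qed.

Definition minimal_projection p :=
  [/\ projection p, p <> 0 & forall q, projection q -> p * q = q -> q = 0 \/ q = p].

(** For self-adjoint a in p M p, a projection e in the bicommutant of a commutes
    with p, so e p is 0 or p by minimality and the linear map
    z |-> z p - <z u, u> p vanishes at e.  Hence it vanishes at a. *)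
Lemma minimal_corner p : minimal_projection p ->
  exists2 u : H, rnorm u = 1 & forall x : M, p * x * p = inner (x u) u *: p.
Proof.
move=> [pp p0 pmin].
have [v pv] : exists v, p v <> 0.
  by apply: contrapT => /forallNP h; apply: p0; apply: vna_ext => v; exact: contrapT (h v).
pose u : H := ((rnorm (p v))^-1)%:C *: p v.
have pv0 : p v != 0 by apply/eqP.
have u1 : rnorm u = 1.
  by rewrite rnormZr ger0_norm ?invr_ge0 ?rnorm_ge0// mulVf// gt_eqF// rnorm_gt0.
have pu : p u = u by rewrite linearZ/= projectionK.
have uu : inner u u = 1 by rewrite inner_rnorm u1 expr1n.
exists u => // x.
have form_lin (k : R[i]) (z z' : M) :
    inner ((k *: z + z') u) u = k * inner (z u) u + inner (z' u) u.
  by rewrite -[(k *: z + z') u]/(k *: z u + z' u) innerDl innerZl.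
have form_bounded : bounded (fun z : M => inner (z u) u *: p).
  exists (rnorm p) => z; rewrite rnormZ mulrC ler_wpM2l ?rnorm_ge0//.
  rewrite (le_trans (rnorm_inner _ _))// u1 mulr1.
  by rewrite (le_trans (rnorm_vna _ _))// u1 mulr1.
have sa_case (y : M) : selfadjoint y -> p * y * p = inner (y u) u *: p.
  move=> sy; pose a := p * y * p.
  have sa : selfadjoint a.
    move=> s t; rewrite -[LHS]/(inner (p (y (p s))) t) -[RHS]/(inner s (p (y (p t)))).
    by rewrite !(proj1 pp, sy).
  have pa : p * a = a by rewrite /a !mulrA (proj2 pp).
  have ap : a * p = a by rewrite /a -!mulrA (proj2 pp).
  have au : inner (a u) u = inner (y u) u.
    by rewrite -[a u]/(p (y (p u))) (proj1 pp) pu.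
  suff : a * p - inner (a u) u *: p = 0.
    by rewrite ap au => /eqP; rewrite subr_eq0 => /eqP.
  apply: (vanish_selfadjoint (T := fun z : M => z * p - inner (z u) u *: p) _ _ sa).
  - move=> k z z'; rewrite mulrDl -vna_scalerAl form_lin scalerDl -scalerA.
    by rewrite opprD addrACA -scalerBr.
  - by apply: boundedD; [exact: bounded_mulr|exact: boundedN].
  - move=> e pe ea; have ep : p * e = e * p by apply: ea; rewrite pa ap.
    have peq : projection (e * p).
      split; last by rewrite -mulrA (mulrA p) ep -mulrA (proj2 pp) mulrA (proj2 pe).
      move=> s t; rewrite -{2}ep -[LHS]/(inner (e (p s)) t) -[RHS]/(inner s (p (e t))).
      by rewrite (proj1 pe) (proj1 pp).
    have eu : e u = (e * p) u by rewrite -{1}pu.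
    have [|h|h] := pmin (e * p) peq; first by rewrite -ep mulrA (proj2 pp).
      by rewrite eu h -[X in inner X]/(0 : H) inner0l scale0r subrr.
    by rewrite eu h pu uu scale1r subrr.
apply/eqP; rewrite -subr_eq0; apply/eqP.
apply: (vanish_on_projections (T := fun z : M => p * z * p - inner (z u) u *: p)).
- move=> k z z'; rewrite mulrDr mulrDl -vna_scalerAr -vna_scalerAl form_lin scalerDl.
  by rewrite -scalerA opprD addrACA -scalerBr.
- apply: boundedD; last exact: boundedN.
  by apply: (bounded_comp (bounded_mulr p)); exact: bounded_mull.
- by move=> e pe; rewrite sa_case ?subrr//; case: pe.
Qed.

End CentralProjections.

(** * Automatic continuity *)

Section AutomaticContinuity.
Context {R : realType} {H : hilbertType R} (M : vonNeumannAlgebra H).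
Variable delta : {linear M -> M}.
Hypothesis delta_projr :
  forall e x : M, projection e -> delta (x * e) = delta x * e + x * delta e.
Hypothesis delta_projl :
  forall e x : M, projection e -> delta (e * x) = delta e * x + e * delta x.
Implicit Types (a b c e p q : M) (v w : H).

(** Gliding hump.  Otherwise choose small x_n with e_n D(x_n) huge and put
    l = sum e_n x_n.  Since e_n l = e_n x_n, the Leibniz rule compares e_n D(l) with
    e_n D(x_n) up to 2 |D(e_n)|, so D(l) would have norm at least n for all n. *)
Lemma orthogonal_projections_bounded (e : nat -> M) : (forall n, projection (e n)) ->
  (forall n m, n <> m -> e n * e m = 0) -> exists n, bounded (fun x : M => e n * delta x).
Proof.
move=> pe oe; apply: contrapT => /forallNP unb.
have h0 n : 0 < (2^-1 ^+ n : R) by rewrite exprn_gt0 ?invr_gt0.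
have /choice[x xP] : forall n, exists x : M, rnorm x <= 2^-1 ^+ n.+1 /\
    n%:R + 2 * rnorm (delta (e n)) < rnorm (e n * delta x).
  move=> n; have /forallNP/(_ ((n%:R + 2 * rnorm (delta (e n))) / 2^-1 ^+ n.+1)) := unb n.
  move=> /existsNP[x /negP]; rewrite -ltNge => xn.
  have x0 : 0 < rnorm x.
    apply: rnorm_gt0; apply/eqP => x0; move: xn.
    by rewrite x0 linear0 mulr0 !rnorm0 mulr0 ltxx.
  pose k := 2^-1 ^+ n.+1 / rnorm x; have k0 : 0 < k by rewrite divr_gt0.
  exists (k%:C *: x); split.
    by rewrite rnormZr gtr0_norm// divfK// gt_eqF.
  rewrite linearZ/= -vna_scalerAr rnormZr gtr0_norm// -ltr_pdivrMl//.
  by rewrite invf_div [ltLHS]mulrC mulrA mulrAC.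
pose u n : M := \sum_(k < n) e k * x k.
have uS n : u n.+1 = u n + e n * x n by rewrite /u big_ord_recr.
pose t n : R := - 2^-1 ^+ n.
have ut n : rnorm (u n.+1 - u n) <= t n.+1 - t n.
  rewrite uS addrAC subrr add0r (le_trans (rnormM _ _))//.
  have -> : t n.+1 - t n = 1 * 2^-1 ^+ n.+1.
    by rewrite /t mul1r opprK exprS; lra.
  by rewrite ler_pM ?rnorm_ge0 ?rnorm_projection_le1//; case: (xP n).
have [l lu] := vna_complete ut geometric_cvg0.
have l1 : rnorm l <= 1.
  by have := lu 0%N; rewrite /u big_ord0 subr0 /t expr0 opprK add0r.
have eu n m : e n * u m = if (n < m)%N then e n * x n else 0.
  elim: m => [|m IH]; first by rewrite /u big_ord0 mulr0.
  rewrite uS mulrDr IH mulrA ltnS [(n <= m)%N]leq_eqVlt.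
  have [->|/eqP nm] := eqVneq n m.
    by rewrite ltnn/= add0r (proj2 (pe m)).
  by rewrite oe// mul0r addr0.
have el n : e n * l = e n * x n.
  apply/eqP; rewrite -subr_eq0 -mulrBr; apply/eqP.
  (* Dropping the first n + 1 terms makes e n kill the whole shifted sequence. *)
  apply: (bounded_kernel_closed (T := fun z : M => e n * z)
    (u := fun m => u (m + n.+1)%N - x n) (t := fun m => t (m + n.+1)%N) (B := 0)).
  - by move=> a b; rewrite mulrBr.
  - exact: bounded_mull.
  - by rewrite (cvg_shiftn n.+1); exact: geometric_cvg0.
  - by move=> m; rewrite opprB addrA subrK.
  - by move=> m; rewrite mulrBr eu leq_addl subrr.
have bd n : n%:R <= rnorm (delta l).
  have [xn1 xn2] := xP n.
  have hx1 : rnorm (x n) <= 1.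
    by rewrite (le_trans xn1)// exprn_ile1 ?invr_ge0// invf_le1// ler1n.
  have E : e n * delta (x n) = e n * delta l + delta (e n) * (l - x n).
    have h : delta (e n) * l + e n * delta l = delta (e n) * x n + e n * delta (x n).
      by rewrite -!delta_projl// el.
    apply: (addrI (delta (e n) * x n)); rewrite -h mulrBr addrCA.
    by rewrite [delta (e n) * x n + _]addrC subrK addrC.
  have h1 : rnorm (e n * delta l) <= 1 * rnorm (delta l).
    rewrite (le_trans (rnormM _ _))// ler_wpM2r ?rnorm_ge0//.
    exact: rnorm_projection_le1.
  have h2 : rnorm (delta (e n) * (l - x n)) <= rnorm (delta (e n)) * 2.
    rewrite (le_trans (rnormM _ _))// ler_wpM2l ?rnorm_ge0//.
    by rewrite (le_trans (rnormB _ _))//; lra.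
  have h3 := rnormD (e n * delta l) (delta (e n) * (l - x n)).
  by rewrite -E in h3; lra.
have := bd (truncn (rnorm (delta l))).+1.
by rewrite leNgt truncnS_gt.
Qed.

Definition bounded_coef v w := bounded (fun x : M => inner (delta x v) w : R[i]^o).

(** Uniform boundedness for the coefficients.  The factors 1 + |v| and 1 + |w| make
    the normalized family pointwise bounded without singling out zero vectors. *)
Lemma bounded_coef_uniform (A B : set H) :
  (forall v w, A v -> B w -> bounded_coef v w) ->
  exists2 C : R, 0 < C & forall v w x, A v -> B w ->
    rnorm (inner (delta x v) w : R[i]^o) <= C * ((1 + rnorm v) * (1 + rnorm w)) * rnorm x.
Proof.
move=> AB; pose N v w : R := (1 + rnorm v) * (1 + rnorm w).
have N1 v : 0 < 1 + rnorm v by rewrite ltr_pwDl// rnorm_ge0.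
have N0 v w : 0 < N v w by rewrite mulr_gt0.
pose I := {vw : H * H | A vw.1 /\ B vw.2}.
pose T (i : I) (x : M) : R[i]^o :=
  ((N (sval i).1 (sval i).2)^-1)%:C * inner (delta x (sval i).1) (sval i).2.
have TE (i : I) x : rnorm (T i x) = (N (sval i).1 (sval i).2)^-1 *
    rnorm (inner (delta x (sval i).1) (sval i).2 : R[i]^o).
  by rewrite [LHS](@rnormZr _ R[i]^o) gtr0_norm// invr_gt0.
have [C CP] : exists C : R, forall i x, rnorm (T i x) <= C * rnorm x.
  apply: (uniform_boundedness (@vna_complete _ _ M)).
  - move=> i k x y; rewrite /T linearP.
    rewrite -[(k *: delta x + delta y) _]/(k *: delta x (sval i).1 + delta y (sval i).1).
    by rewrite innerDl innerZl mulrDr mulrCA.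
  - move=> i; have [Ai Bi] := svalP i; have [C CP] := AB _ _ Ai Bi.
    exists ((N (sval i).1 (sval i).2)^-1 * C) => x.
    by rewrite TE -mulrA ler_wpM2l// invr_ge0 ltW.
  - move=> x; exists (rnorm (delta x)) => i; rewrite TE ler_pdivrMl// mulrC.
    set v := (sval i).1; set w := (sval i).2.
    rewrite (le_trans (rnorm_inner _ _))//.
    rewrite (le_trans (ler_wpM2r (rnorm_ge0 w) (rnorm_vna _ _)))//.
    rewrite -mulrA ler_wpM2l ?rnorm_ge0// /N.
    by have := rnorm_ge0 v; have := rnorm_ge0 w; nra.
exists (`|C| + 1) => [|v w x Av Bw]; first by rewrite ltr_wpDl.
have := CP (exist _ (v, w) (conj Av Bw)) x; rewrite TE/= ler_pdivrMl// => /le_trans; apply.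
rewrite -/(N v w) (mulrA (N v w)) ler_wpM2r ?rnorm_ge0// [leLHS]mulrC ler_wpM2r ?(ltW (N0 v w))//.
by rewrite (le_trans (ler_norm _))// lerDl.
Qed.

(** The constant of [bounded_coef_uniform] survives the passage to the limit. *)
Lemma bounded_coef_closed_r (B : set H) v w : (forall w, B w -> bounded_coef v w) ->
  (forall e : R, 0 < e -> exists2 w', B w' & rnorm (w - w') <= e) -> bounded_coef v w.
Proof.
move=> Bg wB.
have [C C0 CP] : exists2 C : R, 0 < C & forall v' w x, v' = v -> B w ->
    rnorm (inner (delta x v') w : R[i]^o) <= C * ((1 + rnorm v') * (1 + rnorm w)) * rnorm x.
  by apply: (bounded_coef_uniform (A := [set v])) => v' w' -> /Bg.
(* Approximants are taken within distance 1, hence the constant 2. *)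
exists (C * ((1 + rnorm v) * (2 + rnorm w))) => x.
apply/ler_addgt0Pr => eps eps0.
have K0 : 0 < rnorm (delta x v) + 1 by rewrite ltr_wpDl// rnorm_ge0.
have [|w' Bw'] := wB (minr 1 (eps / (rnorm (delta x v) + 1))).
  by rewrite lt_min ltr01 divr_gt0.
rewrite le_min => /andP[ww1 ww2].
rewrite -(subrK w' w) innerDr (le_trans (rnormD _ _))// addrC lerD//.
  rewrite (le_trans (CP v w' x erefl Bw'))// ler_wpM2r ?rnorm_ge0//.
  rewrite ler_wpM2l ?(ltW C0)// ler_wpM2l ?addr_ge0 ?rnorm_ge0//.
  rewrite subrK; have := rnormB w (w - w'); rewrite subKr; lra.
rewrite (le_trans (rnorm_inner _ _))//.
rewrite (le_trans (ler_wpM2l (rnorm_ge0 _) ww2))// mulrCA ler_piMr ?(ltW eps0)//.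
by rewrite ler_pdivrMr// mul1r lerDl.
Qed.

Lemma bounded_coef_closed_l (A : set H) v w :
  (forall v, A v -> bounded_coef v w) ->
  (forall e : R, 0 < e -> exists2 v', A v' & rnorm (v - v') <= e) -> bounded_coef v w.
Proof.
move=> Ag vA.
have [C C0 CP] : exists2 C : R, 0 < C & forall v w' x, A v -> w' = w ->
    rnorm (inner (delta x v) w' : R[i]^o) <= C * ((1 + rnorm v) * (1 + rnorm w')) * rnorm x.
  by apply: (bounded_coef_uniform (B := [set w])) => v' w' /Ag + ->.
exists (C * ((2 + rnorm v) * (1 + rnorm w))) => x.
apply/ler_addgt0Pr => eps eps0.
have K0 : 0 < rnorm (delta x) * rnorm w + 1.
  by rewrite ltr_wpDl// mulr_ge0// rnorm_ge0.
have [|v' Av'] := vA (minr 1 (eps / (rnorm (delta x) * rnorm w + 1))).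
  by rewrite lt_min ltr01 divr_gt0.
rewrite le_min => /andP[vv1 vv2].
have -> : delta x v = delta x (v - v') + delta x v' by rewrite -linearD subrK.
rewrite innerDl (le_trans (rnormD _ _))// addrC lerD//.
  rewrite (le_trans (CP v' w x Av' erefl))// ler_wpM2r ?rnorm_ge0//.
  rewrite ler_wpM2l ?(ltW C0)// ler_wpM2r ?addr_ge0 ?rnorm_ge0//.
  have := rnormB v (v - v'); rewrite subKr; lra.
rewrite (le_trans (rnorm_inner _ _))//.
rewrite (le_trans (ler_wpM2r (rnorm_ge0 w) (rnorm_vna _ _)))// mulrAC.
rewrite (le_trans (ler_wpM2l _ vv2)) ?mulr_ge0 ?rnorm_ge0//.
by rewrite mulrCA ler_piMr ?(ltW eps0)// ler_pdivrMr// mul1r lerDl.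
Qed.

Lemma bounded_coef_linr v k w w' : bounded_coef v w -> bounded_coef v w' ->
  bounded_coef v (k *: w + w').
Proof.
move=> [C CP] [D DP]; exists (rnorm (conjc k : R[i]^o) * C + D) => x.
rewrite innerDr innerZr (le_trans (rnormD _ _))// mulrDl lerD//.
by rewrite [leLHS](@rnormZ _ R[i]^o) -mulrA ler_wpM2l ?rnorm_ge0.
Qed.

Lemma bounded_coef_linl v v' k w : bounded_coef v w -> bounded_coef v' w ->
  bounded_coef (k *: v + v') w.
Proof.
move=> [C CP] [D DP]; exists (rnorm (k : R[i]^o) * C + D) => x.
have -> : delta x (k *: v + v') = k *: delta x v + delta x v' by exact: linearP.
rewrite innerDl innerZl (le_trans (rnormD _ _))// mulrDl lerD//.
by rewrite [leLHS](@rnormZ _ R[i]^o) -mulrA ler_wpM2l ?rnorm_ge0.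
Qed.

Lemma bounded_coef0r v : bounded_coef v 0.
Proof. by exists 0 => x; rewrite inner0r rnorm0 mul0r. Qed.

Lemma bounded_coef0l w : bounded_coef 0 w.
Proof. by exists 0 => x; rewrite [delta x 0]linear0 inner0l rnorm0 mul0r. Qed.

Lemma bounded_coef_of_projection e v w : projection e ->
  bounded (fun x : M => e * delta x) -> bounded_coef v (e w).
Proof.
move=> [se _] [C CP]; exists (C * (rnorm v * rnorm w)) => x.
rewrite -se -[e _]/((e * delta x) v) (le_trans (rnorm_inner _ _))//.
rewrite (le_trans (ler_wpM2r (rnorm_ge0 w) (rnorm_vna _ _)))//.
by rewrite -[leLHS]mulrA [leRHS]mulrAC ler_wpM2r// mulr_ge0// rnorm_ge0.
Qed.

(** Operators of the commutant move from one side of a coefficient to the other. *)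
Lemma bounded_coef_commutant (b b' : bounded_op H H) v w :
  commutant (vna_set M) b -> is_adjoint b b' ->
  bounded_coef (b v) w <-> bounded_coef v (b' w).
Proof.
move=> Mb bb'; have E x : inner (delta x (b v)) w = inner (delta x v) (b' w).
  by rewrite -(commutantP _ _ Mb) bb'.
by split => -[C CP]; exists C => x; [rewrite -E|rewrite E].
Qed.

Lemma bounded_matrix_coef (a b : M) v w :
  bounded (fun x : M => inner (a (x (b v))) w : R[i]^o).
Proof.
exists (rnorm a * rnorm (b v) * rnorm w) => x; rewrite (le_trans (rnorm_inner _ _))//.
rewrite [leRHS]mulrAC ler_wpM2r ?rnorm_ge0//.
rewrite (le_trans (rnorm_vna _ _))// -mulrA ler_wpM2l ?rnorm_ge0// mulrC.
exact: rnorm_vna.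
Qed.

(** The goal is to show that this is all of H: then delta is bounded, by
    [bounded_coef_uniform]. *)
Definition continuity_space : set H := [set w | forall v, bounded_coef v w].

Lemma continuity_space_closed : closed_subspace continuity_space.
Proof.
split=> [v|k w w' Bw Bw' v|w wB v]; first exact: bounded_coef0r.
  by apply: bounded_coef_linr; [exact: Bw|exact: Bw'].
by apply: bounded_coef_closed_r wB => w' Bw'; exact: Bw'.
Qed.

Lemma continuity_space_commutant (b : bounded_op H H) : commutant (vna_set M) b ->
  forall w, continuity_space w -> continuity_space (b w).
Proof.
move=> Mb w Bw v; have [b' bb'] := adjoint_exists b.
have b'b := is_adjoint_sym bb'.
by apply/(bounded_coef_commutant v w (commutant_adjoint Mb bb') b'b)/Bw.
Qed.

(** By the Leibniz rule e D(x) = D(e x) - D(e) x. *)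
Lemma continuity_space_projection e : projection e ->
  forall w, continuity_space w -> continuity_space (e w).
Proof.
move=> pe w Bw v; have [se _] := pe.
apply: (@bounded_ext _ _ _ (fun x : M =>
  inner (delta (e * x) v) w - inner (delta e (x ((1 : M) v))) w : R[i]^o)).
  move=> x; rewrite -se delta_projl// -innerBl; congr (inner _ _).
  rewrite -[(delta e * x + e * delta x) v]/(delta e (x v) + e (delta x v)).
  by rewrite addrAC subrr add0r.
apply: boundedD; first exact: bounded_comp (Bw v) (bounded_mull e).
exact/boundedN/bounded_matrix_coef.
Qed.

(** The Leibniz rule expresses p D(x) p through D(p x p) = <x u, u> D(p) and terms
    in which D is applied only to p. *)
Lemma minimal_bounded_coef p v w : minimal_projection p -> bounded_coef (p v) (p w).
Proof.
move=> mp; have [u u1 pE] := minimal_corner mp; have [pp _ _] := mp; have [sp _] := pp.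
apply: (@bounded_ext _ _ _ (fun x : M =>
  inner (inner (x u) u *: p (delta p v)) w -
  (inner (p (delta p (x (p v)))) w + inner (p (x (delta p v))) w) : R[i]^o)).
  move=> x; rewrite -sp; have := delta_projl (x * p) pp.
  rewrite (delta_projr x pp) mulrA pE linearZ/= => E.
  have -> : inner (x u) u *: p (delta p v) = p ((inner (x u) u *: delta p) v).
    by rewrite -[(_ *: delta p) v]/(inner (x u) u *: delta p v) linearZ.
  rewrite E -[X in p X]/(delta p (x (p v)) + p (delta x (p v) + x (delta p v))).
  by rewrite !linearD/= !(projectionK _ pp) !innerDl; ring.
apply: boundedD; last first.
  apply/boundedN/boundedD; first exact: (bounded_matrix_coef (p * delta p) p).
  exact: (bounded_matrix_coef p (delta p)).
exists (rnorm (p (delta p v)) * rnorm w) => x.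
rewrite (le_trans (rnorm_inner _ _))// rnormZ -[leLHS]mulrA [leRHS]mulrC.
rewrite ler_wpM2r ?mulr_ge0 ?rnorm_ge0// (le_trans (rnorm_inner _ _))//.
by rewrite (le_trans (ler_wpM2r _ (rnorm_vna _ _))) ?rnorm_ge0// u1 !mulr1.
Qed.

(** The vectors v having bounded coefficients against the range of p form the range
    of a central projection d with d p = p.  Hence p D(x) = p D(x) d, and these
    coefficients only see the component of v in the range of d. *)
Lemma minimal_continuity_space p : minimal_projection p -> forall w, continuity_space (p w).
Proof.
move=> mp; have [pp _ _] := mp; have [sp _] := pp.
pose S : set H := [set v | forall w, bounded_coef v (p w)].
have Scs : closed_subspace S.
  split=> [w|k v v' Sv Sv' w|v vS w]; first exact: bounded_coef0l.
    by apply: bounded_coef_linl; [exact: Sv|exact: Sv'].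
  by apply: bounded_coef_closed_l vS => v' Sv'; exact: Sv'.
have Sinv (b : bounded_op H H) : commutant (vna_set M) b -> forall v, S v -> S (b v).
  move=> Mb v Sv w; have [b' bb'] := adjoint_exists b.
  apply/(bounded_coef_commutant v (p w) Mb bb').
  by rewrite (commutantP _ _ (commutant_adjoint Mb bb')); exact: Sv.
have Se e : projection e -> forall v, S v -> S (e v).
  move=> pe v Sv w.
  apply: (@bounded_ext _ _ _ (fun x : M =>
    inner (delta (x * e) v) (p w) - inner ((1 : M) (x (delta e v))) (p w) : R[i]^o)).
    move=> x; rewrite delta_projr// -innerBl; congr (inner _ _).
    rewrite -[(delta x * e + x * delta e) v]/(delta x (e v) + x (delta e v)).
    by rewrite addrK.
  apply: boundedD; first exact: bounded_comp (Sv w) (bounded_mulr e).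
  exact/boundedN/bounded_matrix_coef.
have [d [pd dS dC]] := central_projection Scs Sinv Se.
have dp : d * p = p.
  apply: vna_ext => v; apply: (projection_fix Scs dS) => w.
  exact: minimal_bounded_coef.
move=> w v; have := projection_mem dS v => /(_ w)[C CP]; exists C => x.
have -> : inner (delta x v) (p w) = inner (delta x (d v)) (p w); last exact: CP.
rewrite -!sp -[p (delta x (d v))]/((p * (delta x * d)) v) -dC mulrA.
by rewrite -[p * d]dC dp.
Qed.

(** Without minimal projections below 1 - c, one could choose q_0 > q_1 > ... below
    1 - c; the differences q_n - q_(n+1) are orthogonal and nonzero, against
    [orthogonal_projections_bounded]. *)
Lemma minimal_projection_exists c : projection c -> c <> 1 ->
  (forall e, projection e -> c * e = 0 ->
     bounded (fun x : M => e * delta x) -> e = 0) ->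
  exists2 p, minimal_projection p & c * p = 0.
Proof.
move=> pc c1 unb; apply: contrapT => nomin.
pose X := {q : M | [/\ projection q, q <> 0 & c * q = 0]}.
have /choice[f fP] : forall q : X, exists q' : X,
    sval q * sval q' = sval q' /\ sval q' <> sval q.
  move=> [q [pq q0 cq]] /=; apply: contrapT => h; apply: nomin; exists q => //.
  split => // q' pq' qq'; have [->|/eqP q'0] := eqVneq q' 0; first by left.
  right; apply: contrapT => q'q; apply: h.
  have Xq' : [/\ projection q', q' <> 0 & c * q' = 0].
    by split => //; rewrite -qq' mulrA cq mul0r.
  by exists (exist _ q' Xq').
have X0 : [/\ projection (1 - c), 1 - c <> 0 & c * (1 - c) = 0].
  split; first exact: projection_comp.
    by move=> /eqP; rewrite subr_eq0 => /eqP/esym.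
  by rewrite mulrBr mulr1 (proj2 pc) subrr.
pose s n : X := iter n f (exist _ (1 - c) X0).
pose q n := sval (s n).
have qP n : [/\ projection (q n), q n <> 0 & c * q n = 0] by exact: (svalP (s n)).
have qq n : q n * q n.+1 = q n.+1 by exact: (proj1 (fP (s n))).
have qne n : q n.+1 <> q n by exact: (proj2 (fP (s n))).
have pq n : projection (q n) by case: (qP n).
have qle n m : (n <= m)%N -> q n * q m = q m.
  move=> /subnK <-; elim: (m - n)%N => [|k IH]; first by have [[]] := qP n.
  by rewrite addSn -qq mulrA IH.
have qge n m : (n <= m)%N -> q m * q n = q m.
  by move=> nm; apply: subprojection_comm => //; exact: qle.
pose e n := q n - q n.+1.
have pe n : projection (e n) by exact: projection_sub.
have [n bn] : exists n, bounded (fun x : M => e n * delta x).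
  apply: orthogonal_projections_bounded => // n m /eqP; rewrite /e mulrBl !mulrBr.
  rewrite neq_ltn => /orP[nm|mn].
    by rewrite !qle ?subrr// ?ltnS// ltnW// ltnS ltnW.
  by rewrite !qge ?subrr// ?ltnS// ltnW// ltnS ltnW.
have := unb _ (pe n) _ bn; rewrite /e mulrBr.
have [_ _ ->] := qP n; have [_ _ ->] := qP n.+1.
by rewrite subrr => /(_ erefl)/eqP; rewrite subr_eq0 => /eqP/esym/qne.
Qed.

Theorem automatic_continuity : bounded delta.
Proof.
have [c [pc cS cC]] := central_projection continuity_space_closed
  continuity_space_commutant continuity_space_projection.
have c1 : c = 1.
  apply: contrapT => c1.
  have [|p mp cp] := minimal_projection_exists pc c1.
    move=> e pe ce be; rewrite -ce; apply: vna_ext => w; apply/esym.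
    apply: (projection_fix continuity_space_closed cS) => v.
    exact: bounded_coef_of_projection.
  have [_ p0 _] := mp; apply: p0; rewrite -cp; apply: vna_ext => w; apply/esym.
  by apply: (projection_fix continuity_space_closed cS); exact: minimal_continuity_space.
have [C C0 CP] := bounded_coef_uniform (A := setT) (B := setT)
  (fun v w _ _ => (eq_ind c (fun c : M => continuity_space (c w)) (projection_mem cS w) 1 c1) v).
exists (C * 4) => x; apply: rnorm_vna_le => [|v].
  by rewrite mulr_ge0 ?rnorm_ge0// mulr_ge0 ?ltW.
have [->|v0] := eqVneq v 0; first by rewrite linear0 !rnorm0 mulr0.
have [->|y0] := eqVneq (delta x v) 0.
  by rewrite rnorm0 !mulr_ge0 ?rnorm_ge0// ltW.
have nv := rnorm_gt0 v0; have ny := rnorm_gt0 y0.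
have := CP (((rnorm v)^-1)%:C *: v) (((rnorm (delta x v))^-1)%:C *: delta x v) x I I.
rewrite [delta x (_ *: v)]linearZ/= innerZl innerZr conjc_real inner_rnorm.
rewrite -!real_complexM rnorm_real.
rewrite !rnormZr !gtr0_norm ?invr_gt0// ?mulr_gt0 ?invr_gt0 ?exprn_gt0//.
rewrite !mulVf ?gt_eqF// expr2 mulKf ?gt_eqF// ler_pdivrMl//.
have -> : (1 + 1) * (1 + 1) = 4 :> R by ring.
by rewrite mulrC.
Qed.

End AutomaticContinuity.

(** * Derivations at zero and idempotents *)

Section DerivationAtZero.
Variables (A : pzRingType) (delta : {additive A -> A}).
Hypothesis delta0 : derivation_at_zero delta.
Implicit Types (e x : A).

(** Compare the conditions at the zero products e (1 - e) and (1 - e) e. *)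
Lemma derivation_at_zero_unit_comm e : e * e = e -> delta 1 * e = e * delta 1.
Proof.
move=> ee.
have /delta0 h1 : e * (1 - e) = 0 by rewrite mulrBr mulr1 ee subrr.
have /delta0 h2 : (1 - e) * e = 0 by rewrite mulrBl mul1r ee subrr.
apply: (addIr (delta e - delta e * e - e * delta e)).
transitivity (0 : A).
  by rewrite -h2 raddfB/= !mulrBl mul1r addrACA !addrA.
by rewrite -h1 raddfB/= !mulrBr mulr1 addrCA.
Qed.

Hypothesis delta1 : delta 1 = 0.

(** Compare the conditions at the zero products (x e) (1 - e) and (x (1 - e)) e. *)
Lemma derivation_at_zero_idemr e x : e * e = e ->
  delta (x * e) = delta x * e + x * delta e.
Proof.
move=> ee.
have /delta0 h1 : (x * e) * (1 - e) = 0 by rewrite -mulrA mulrBr mulr1 ee subrr mulr0.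
have /delta0 h2 : (x - x * e) * e = 0 by rewrite mulrBl -mulrA ee subrr.
apply: (addIr (- (delta (x * e) * e) - x * e * delta e)).
transitivity (0 : A).
  by rewrite -h1 raddfB/= delta1 sub0r mulrN mulrBr mulr1 !addrA.
by rewrite -h2 raddfB/= !mulrBl addrACA.
Qed.

(** Compare the conditions at the zero products (1 - e) (e x) and e ((1 - e) x). *)
Lemma derivation_at_zero_ideml e x : e * e = e ->
  delta (e * x) = delta e * x + e * delta x.
Proof.
move=> ee.
have /delta0 h1 : (1 - e) * (e * x) = 0 by rewrite mulrA mulrBl mul1r ee subrr mul0r.
have /delta0 h2 : e * (x - e * x) = 0 by rewrite mulrBr mulrA ee subrr.
apply: (addIr (- (delta e * (e * x)) - e * delta (e * x))).
transitivity (0 : A).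
  by rewrite -h1 raddfB/= delta1 sub0r mulNr mulrBl mul1r addrCA.
by rewrite -h2 raddfB/= !mulrBr addrACA.
Qed.

End DerivationAtZero.

(** * The theorem *)

Section Main.
Context {R : realType} {H : hilbertType R} (M : vonNeumannAlgebra H).
Implicit Types (a b x : M).

Lemma derivation_at_zero_normalized (D : {linear M -> M}) :
  derivation_at_zero D -> D 1 = 0 -> bounded D /\ derivation D.
Proof.
move=> D0 D1.
have Dr e x : projection e -> D (x * e) = D x * e + x * D e.
  by move=> [_ ee]; exact: derivation_at_zero_idemr.
have Dl e x : projection e -> D (e * x) = D e * x + e * D x.
  by move=> [_ ee]; exact: derivation_at_zero_ideml.
have bD := automatic_continuity Dr Dl; split => // a b.
apply/eqP; rewrite -subr_eq0; apply/eqP.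
apply: (vanish_on_projections (T := fun z : M => D (a * z) - (D a * z + a * D z))).
- move=> k z z'; have DP y y' : D (k *: y + y') = k *: D y + D y' by exact: linearP.
  rewrite !mulrDr -!vna_scalerAr !DP mulrDr -!vna_scalerAr [X in _ - X]addrACA.
  by rewrite -scalerDr opprD addrACA -scalerBr.
- apply: boundedD; first exact: bounded_comp bD (bounded_mull a).
  apply/boundedN/boundedD; first exact: bounded_mull.
  exact: bounded_comp (bounded_mull a) bD.
- by move=> e pe; rewrite Dr// subrr.
Qed.

Lemma evaluationD (X : normedModType R[i]) (x y : X) :
  evaluation (x + y) = evaluation x + evaluation y.
Proof. by apply: bounded_opP => phi; exact: linearD. Qed.

Lemma evaluationN (X : normedModType R[i]) (x : X) : evaluation (- x) = - evaluation x.
Proof. by apply: bounded_opP => phi; exact: linearN. Qed.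

Lemma bounded_continuous (V W : normedModType R[i]) (f : {linear V -> W}) :
  bounded f -> continuous f.
Proof.
move=> /bounded_gt0[C C0 fC].
have : (f : V -> W) \in @bounded_linear R V W.
  apply/bounded_linearP; split; first exact: linearP.
  by exists C => [|x]; [exact: ltW|rewrite -rnorm_leP].
by rewrite inE/= => /asboolP/asboolP[].
Qed.

(** Multiplication by the central element delta 1 preserves zero products, so it can
    be subtracted. *)
Lemma derivation_at_zero_decomposition (delta : {linear M -> M}) :
  derivation_at_zero delta ->
  exists D : {linear M -> M}, [/\ bounded D, derivation D,
    forall a, delta 1 * a = a * delta 1 & forall a, delta a = D a + delta 1 * a].
Proof.
move=> d0; set h := delta 1.
have hC : forall a, h * a = a * h.
  by apply: central_of_projections => e [_ ee]; exact: derivation_at_zero_unit_comm.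
have [D DE] : exists D : {linear M -> M}, (fun a => delta a - h * a) = D.
  apply: linear_pack => k a b; rewrite linearP mulrDr -vna_scalerAr.
  by rewrite opprD addrACA -scalerBr.
have Da a : D a = delta a - h * a by rewrite -DE.
have [bD dD] : bounded D /\ derivation D.
  apply: derivation_at_zero_normalized; last by rewrite Da mulr1 subrr.
  move=> a b ab; rewrite !Da mulrBl mulrBr addrACA d0// add0r.
  by rewrite -mulrA ab mulr0 mulrA -hC -mulrA ab mulr0 subr0 oppr0.
by exists D; split => // a; rewrite Da subrK.
Qed.

End Main.

Theorem corollary2p16 (R : realType) (H : hilbertType R)
    (M : vonNeumannAlgebra H) (delta : {linear M -> M}) :
  derivation_at_zero delta ->
  (continuous delta /\ generalized_derivation delta) /\
  (delta 1 = 0 -> derivation delta).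
Proof.
move=> d0; have [D [bD dD hC dE]] := derivation_at_zero_decomposition d0.
have dM a b : delta (a * b) = delta a * b + a * delta b - a * delta 1 * b.
  rewrite [delta (a * b)]dE dD [delta a]dE [delta b]dE mulrDl mulrDr.
  rewrite addrACA [a * (_ * b)]mulrA -hC -[in RHS]mulrA.
  by rewrite addrA addrK.
split; first split.
- apply: bounded_continuous.
  apply: (bounded_ext (S := fun a => D a + delta 1 * a)); first by move=> a; rewrite -dE.
  by apply: boundedD => //; exact: bounded_mull.
- exists (evaluation (delta 1)) => a b.
  by rewrite !arens_evaluation -evaluationN -!evaluationD dM.
- by move=> d1 a b; rewrite dM d1 mulr0 mul0r subr0.
Qed.
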